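(* Let $k$ be a field, let $n\ge 3$, and let $I$ be a nonzero proper radical ideal of the polynomial ring $R=k[x_1,\ldots,x_n]$. Let $I=I_1\cap\cdots\cap I_n$ be an equidimensional decomposition of $I$. Then at least one of the following holds: (i) $\mathrm{rt}(I)=1$; (ii) $I_i\neq R$ for some $i\in\{2,\ldots,n-1\}$ and $\mathrm{rt}(I)=\mathrm{rt}(I_2\cap\cdots\cap I_{n-1})$. (The two cases are not claimed to be mutually exclusive.)
   Context: Equidimensional decomposition: given an irredundant primary decomposition of a nonzero proper ideal $I$ of $R=k[x_1,\ldots,x_n]$, for each $i=1,\ldots,n$ let $I_{i,1},\ldots,I_{i,r_i}$ be the primary components of $I$ of height $i$ in this decomposition, and set $I_i=I_{i,1}\cap\cdots\cap I_{i,r_i}$, the $i$-th equidimensional component of $I$; if there are no primary components of height $i$, set $I_i=R$. Then $I=I_1\cap\cdots\cap I_n$ is called an equidimensional decomposition of $I$. (When $I$ is radical, the $I_{i,j}$ are exactly the minimal primes of $I$ of height $i$.) Relation type of an ideal: let $I=(f_1,\ldots,f_s)$ be an ideal of a Noetherian (commutative) ring $R$, and let $\mathbf{R}(I)=R[It]=\bigoplus_{q\ge 0}I^qt^q$ be its Rees algebra. Let $R[t_1,\ldots,t_s]$ be the polynomial ring with its standard grading ($\deg t_i=1$, elements of $R$ in degree $0$), let $\varphi:R[t_1,\ldots,t_s]\to\mathbf{R}(I)$ be the graded $R$-algebra homomorphism sending $t_i$ to $f_it$, and let $L=\ker(\varphi)=\bigoplus_{q\ge 1}L_q$. The relation type $\mathrm{rt}(I)$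 is the least integer $N\ge 1$ such that $L$ is generated by its homogeneous elements of degree at most $N$. It is a known fact that $\mathrm{rt}(I)$ does not depend on the chosen finite generating set of $I$. The improper ideal has relation type $1$. *)

(* Defs.v *)
From mathcomp Require Import all_boot all_order all_algebra.
From mathcomp Require Import boolp classical_sets.
From mathcomp Require Export mpoly.

Set Implicit Arguments.
Unset Strict Implicit.
Unset Printing Implicit Defensive.

Import GRing.Theory.
Local Open Scope classical_set_scope.
Local Open Scope ring_scope.

(* Ideals are Prop-valued sets, possibly improper: membership need not be      *)
(* decidable, and the improper ideal setT has to be covered, so the boolean    *)
(* proper ideals of ring_quotient do not apply.                                *)
Section Ideals.
Variable R : comNzRingType.
Implicit Types (I P Q : set R) (A : set R).

Definition is_ideal I : Prop :=
  [/\ I 0, forall x y, I x -> I y -> I (x + y) & forall a x, I x -> I (a * x)].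

Definition ideal_gen A : set R :=
  [set x | exists m (a g : 'I_m -> R),
     (forall i, A (g i)) /\ x = \sum_(i < m) a i * g i].

Definition radical_ideal I : Prop :=
  is_ideal I /\ forall x m, I (x ^+ m) -> I x.

Definition prime_ideal P : Prop :=
  [/\ is_ideal P, P <> setT & forall x y, P (x * y) -> P x \/ P y].

Definition primary_ideal Q : Prop :=
  [/\ is_ideal Q, Q <> setT &
      forall x y, Q (x * y) -> Q x \/ exists m : nat, Q (y ^+ m)].

(* A strict chain of m + 1 primes c 0 < ... < c m = P; the values of c beyond  *)
(* m are irrelevant.                                                           *)
Definition prime_chain_to P (m : nat) : Prop :=
  exists c : nat -> set R,
    [/\ forall i, (i <= m)%N -> prime_ideal (c i),
        forall i, (i < m)%N -> c i `<` c i.+1 & c m = P].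

Definition prime_height P (h : nat) : Prop :=
  prime_chain_to P h /\ forall m, prime_chain_to P m -> (m <= h)%N.

(* ht I = h, as the least height of a prime containing I; a chain of length h  *)
(* ending at P says that P has height at least h, infinity allowed.            *)
Definition ideal_height I (h : nat) : Prop :=
  (exists P, [/\ prime_ideal P, I `<=` P & prime_height P h]) /\
  forall P, prime_ideal P -> I `<=` P -> prime_chain_to P h.

Definition irredundant_primary_decomposition I r (Q : 'I_r -> set R) : Prop :=
  [/\ forall j, primary_ideal (Q j),
      I = \bigcap_j Q j &
      forall j, ~ (\bigcap_(l in [set l | l <> j]) Q l `<=` Q j)].

(* With no component of height i, this is the empty intersection setT.         *)
Definition equidimensional_component r (Q : 'I_r -> set R) (i : nat) : set R :=
  \bigcap_(j in [set j | ideal_height (Q j) i]) Q j.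

(* Only E 1, ..., E n matter.                                                  *)
Definition equidimensional_decomposition (n : nat) I (E : nat -> set R) : Prop :=
  exists r (Q : 'I_r -> set R),
    irredundant_primary_decomposition I Q /\
    forall i, (1 <= i <= n)%N -> E i = equidimensional_component Q i.

End Ideals.

Section RelationType.
Variable R : comNzRingType.

(* The map R[t_1, ..., t_s] -> R[It], t_i |-> f_i t, with codomain enlarged    *)
(* from the Rees algebra R[It] to R[t]; this does not change its kernel.       *)
Definition rees_map s (f : 'I_s -> R) (p : {mpoly R[s]}) : {poly R} :=
  mmap (@polyC R) (fun i => f i *: 'X) p.

Definition rees_equations s (f : 'I_s -> R) : set {mpoly R[s]} :=
  [set p | rees_map f p = 0].

Definition generated_in_degree_le s (L : set {mpoly R[s]}) (N : nat) : Prop :=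
  L = ideal_gen [set p | L p /\ exists2 d, (d <= N)%N & p \is d.-homog].

Definition family_relation_type s (f : 'I_s -> R) (N : nat) : Prop :=
  [/\ (1 <= N)%N, generated_in_degree_le (rees_equations f) N &
      forall M, (1 <= M)%N -> generated_in_degree_le (rees_equations f) M ->
        (N <= M)%N].

(* rt(I) = N. Asking for all finite generating families makes the value unique *)
(* by definition; asking for one to exist excludes vacuity.                    *)
Definition relation_type (I : set R) (N : nat) : Prop :=
  (exists s (f : 'I_s -> R), I = ideal_gen (range f)) /\
  forall s (f : 'I_s -> R), I = ideal_gen (range f) -> family_relation_type f N.

End RelationType.

(* Main.v *)
Require Import Defs.
From HB Require Import structures.
From mathcomp Require Import all_boot all_order all_algebra.
From mathcomp Require Import boolp classical_sets ring zify.

(* Adding a component Q to an intersection K of other components does not      *)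
(* change the relation type when ht Q is 1 or n.                               *)
(* If ht Q = 1, then Q = (p) as k[x_1..x_n] is factorial, p avoids the primes  *)
(* of K, so that the intersection is p K, and K and p K have the same Rees     *)
(* equations. If ht Q = n, then Q is maximal and comaximal with K; localizing  *)
(* at a and b with a + b = 1, a in Q, b in K, shows that the equations of the  *)
(* intersection are generated in degree <= N iff those of Q and of K are, and  *)
(* Q is of linear type, being generated by a triangular sequence g_1, .., g_n  *)
(* with g_i in k[x_1..x_i] monic in x_i.                                       *)
(* Instead of dimension theory, the Coquand-Lombardi argument shows directly   *)
(* that a prime P at the top of a chain of length n has k[x_1..x_n]/P          *)
(* algebraic over k, from which its maximality and the g_i are obtained.       *)

Set Implicit Arguments.
Unset Strict Implicit.
Unset Printing Implicit Defensive.

Import GRing.Theory.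
Local Open Scope classical_set_scope.
Local Open Scope ring_scope.

(** * Ideals and Rees equations *)

(** Since [I] is radical, its irredundant primary components are prime ([radical_component_prime]).
    They are nonzero, so their heights lie between 1 and n ([prime_height_gt0], [prime_chain_le]).
    The ideal I_2 ∩ ... ∩ I_(n-1) is therefore what remains after dropping the components of height
    1 and n, and [rt_le_components] puts these back one at a time without changing the relation
    type. If nothing remains, the intersection is the whole ring and rt(I) = 1.

    Relation types are compared through the upper bounds [rt_le]. A bound does not depend on the
    generating family ([rt_leP]), and ideals with the same bounds N >= 1 have the same relation type
    ([relation_type_transfer]).

    The height 1 case, [rt_le_add_height1], uses [height1_principal], hence factoriality, which
    [kaplansky] and [gauss] give by induction on the number of variables. The height n case,
    [rt_le_add_height_max], combines the local-global argument of [rt_le_comaximal] with linear type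
    of the maximal ideal, [algebraic_prime_rt_le1]. Its algebraicity hypothesis comes from
    [chain_algebraic]. Finite generation, of ideals and of Rees equations, comes from
    [hilbert_basis]. *)

Section IdealTheory.
Variable R : comNzRingType.
Implicit Types (I J P : set R) (A B : set R).

Lemma ideal0 I : is_ideal I -> I 0. Proof. by case. Qed.

Lemma idealD I x y : is_ideal I -> I x -> I y -> I (x + y).
Proof. by case=> _ + _; apply. Qed.

Lemma ideal_mull I a x : is_ideal I -> I x -> I (a * x).
Proof. by case=> _ _; apply. Qed.

Lemma ideal_mulr I a x : is_ideal I -> I x -> I (x * a).
Proof. by rewrite mulrC; apply: ideal_mull. Qed.

Lemma idealN I x : is_ideal I -> I x -> I (- x).
Proof. by move=> idI Ix; rewrite -mulN1r; apply: ideal_mull. Qed.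

Lemma idealB I x y : is_ideal I -> I x -> I y -> I (x - y).
Proof. by move=> idI Ix Iy; apply: idealD => //; apply: idealN. Qed.

Lemma idealBK I x y : is_ideal I -> I (x - y) -> I y -> I x.
Proof. by move=> idI Ixy Iy; rewrite -(subrK y x); apply: idealD. Qed.

Lemma ideal_sum I (T : Type) (r : seq T) (Q : pred T) (F : T -> R) :
  is_ideal I -> (forall i, Q i -> I (F i)) -> I (\sum_(i <- r | Q i) F i).
Proof.
move=> idI IF; elim/big_ind: _ => //; first exact: ideal0.
by move=> x y; apply: idealD.
Qed.

Lemma ideal_setT I : is_ideal I -> I 1 -> I = setT.
Proof.
move=> idI I1; apply/seteqP; split=> // x _.
by rewrite -[x]mulr1; apply: ideal_mull.
Qed.

Lemma ideal_gen_ideal A : is_ideal (ideal_gen A).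
Proof.
split.
- by exists 0%N, (fun=> 0), (fun=> 0); split; [case | rewrite big_ord0].
- move=> _ _ [m [a [g [Ag ->]]]] [m' [a' [g' [Ag' ->]]]].
  pose pick (T : Type) (u : 'I_m -> T) u' (i : 'I_(m + m')) : T :=
    match split i with inl j => u j | inr j => u' j end.
  exists (m + m')%N, (pick _ a a'), (pick _ g g'); split.
    by move=> i; rewrite /pick; case: split.
  rewrite big_split_ord /=; congr (_ + _); apply: eq_bigr => i _.
    by rewrite /pick (unsplitK (inl i)).
  by rewrite /pick (unsplitK (inr i)).
- move=> b _ [m [a [g [Ag ->]]]]; exists m, (fun i => b * a i), g; split=> //.
  by rewrite mulr_sumr; apply: eq_bigr => i _; rewrite mulrA.
Qed.

Lemma sub_ideal_gen A x : A x -> ideal_gen A x.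
Proof.
move=> Ax; exists 1%N, (fun=> 1), (fun=> x); split=> //.
by rewrite big_ord_recl big_ord0 mul1r addr0.
Qed.

Lemma ideal_gen_min A J : is_ideal J -> A `<=` J -> ideal_gen A `<=` J.
Proof.
move=> idJ AJ _ [m [a [g [Ag ->]]]]; apply: ideal_sum => // i _.
by apply: ideal_mull => //; apply: AJ.
Qed.

Lemma ideal_gen_rangeP s (f : 'I_s -> R) x :
  ideal_gen (range f) x <-> exists a, x = \sum_i a i * f i.
Proof.
split; last first.
  move=> [a ->]; exists s, a, f; split=> // i; exact: (imageT f i).
move: x; apply: (@ideal_gen_min _ [set x | exists a, x = \sum_i a i * f i]).
  split.
  - by exists (fun=> 0); rewrite big1 // => i _; rewrite mul0r.
  - move=> _ _ [a ->] [b ->]; exists (fun i => a i + b i).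
    by rewrite -big_split; apply: eq_bigr => i _; rewrite mulrDl.
  - move=> c _ [a ->]; exists (fun i => c * a i).
    by rewrite mulr_sumr; apply: eq_bigr => i _; rewrite mulrA.
move=> _ [i _ <-]; exists (fun j => (j == i)%:R).
rewrite (bigD1 i) //= eqxx mul1r big1 ?addr0 // => j /negbTE ->.
by rewrite mul0r.
Qed.

Lemma mem_range_ideal_gen s (f : 'I_s -> R) i : ideal_gen (range f) (f i).
Proof. by apply: sub_ideal_gen; apply: imageT. Qed.

(** Powers of comaximal elements are comaximal; the two inductions avoid expanding (a + b)^(m +
    l). *)
Lemma ideal_pow_split J a b x m l : is_ideal J -> a + b = 1 ->
  J (a ^+ m * x) -> J (b ^+ l * x) -> J x.
Proof.
move=> idJ ab1.
have key y : J (a * y) -> J (b * y) -> J y.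
  by move=> Ja Jb; rewrite -[y]mul1r -ab1 mulrDl; apply: idealD.
elim: m x => [|m IHm] x; first by rewrite mul1r.
rewrite exprSr -mulrA => Jam Jbl.
have Jax : J (a * x).
  by apply: IHm => //; rewrite mulrCA; apply: ideal_mull.
elim: l x {Jam IHm} Jbl Jax => [|l IHl] x; first by rewrite mul1r.
rewrite exprSr -mulrA => Jbl Jax; apply: key => //.
by apply: IHl => //; rewrite mulrCA; apply: ideal_mull.
Qed.

End IdealTheory.

Lemma ideal_gen_map (R S : comNzRingType) (phi : {rmorphism R -> S}) A B x :
  (forall y, A y -> ideal_gen B (phi y)) -> ideal_gen A x ->
  ideal_gen B (phi x).
Proof.
move=> AB [m [a [g [Ag ->]]]]; rewrite rmorph_sum; apply: ideal_sum.
  exact: ideal_gen_ideal.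
by move=> i _; rewrite rmorphM; apply: ideal_mull; [exact: ideal_gen_ideal|exact: AB].
Qed.

Lemma ideal_preimage (R S : comNzRingType) (phi : {rmorphism R -> S}) I :
  is_ideal I -> is_ideal (phi @^-1` I).
Proof.
move=> idI; split=> [|x y|a x]; rewrite /= ?rmorph0 ?rmorphD ?rmorphM.
- exact: ideal0.
- exact: idealD.
- exact: ideal_mull.
Qed.

Lemma prime_ideal1 (R : comNzRingType) (P : set R) : prime_ideal P -> ~ P 1.
Proof. by move=> [idP PT _] /(ideal_setT idP). Qed.

Lemma prime_ideal_preimage (R S : comNzRingType) (phi : {rmorphism R -> S}) P :
  prime_ideal P -> prime_ideal (phi @^-1` P).
Proof.
move=> prP; have [idP _ prM] := prP; split.
- exact: ideal_preimage.
- move=> PT; apply: (prime_ideal1 prP); rewrite -(rmorph1 phi).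
  by have : (phi @^-1` P) 1 by rewrite PT.
- by move=> x y /=; rewrite rmorphM; apply: prM.
Qed.

(** * Evaluation and homogeneous forms of polynomials *)

Lemma size_drop_lead (R : nzRingType) (p : {poly R}) : p != 0 ->
  (size (p - lead_coef p *: 'X^((size p).-1))%R < size p)%N.
Proof.
move=> p0; rewrite (polySpred p0) ltnS; apply/leq_sizeP => j pj.
rewrite coefB coefZ coefXn; have [->|ne] := eqVneq j (size p).-1.
  by rewrite mulr1 subrr.
rewrite mulr0 subr0; apply: nth_default.
by rewrite (polySpred p0) ltn_neqAle eq_sym ne pj.
Qed.

Lemma lift_max_widen n (i : 'I_n) : lift ord_max i = widen_ord (leqnSn n) i.
Proof. by apply: val_inj; rewrite /= /bump leqNgt ltn_ord. Qed.

Lemma rmorph_mmap n (R S T : comNzRingType) (f : {rmorphism R -> S})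
    (phi : {rmorphism S -> T}) (h : 'I_n -> S) (p : {mpoly R[n]}) :
  phi (mmap f h p) = mmap (phi \o f) (phi \o h) p.
Proof.
rewrite /mmap rmorph_sum; apply: eq_bigr => m _.
rewrite rmorphM /mmap1 rmorph_prod; congr (_ * _).
by apply: eq_bigr => i _; rewrite rmorphXn.
Qed.

Lemma eq_mmap n (R S : nzRingType) (f f' : R -> S) (h h' : 'I_n -> S) p :
  f =1 f' -> h =1 h' -> mmap f h p = mmap f' h' p.
Proof.
move=> ef eh; rewrite /mmap; apply: eq_bigr => m _.
by rewrite ef (mmap1_eq m eh).
Qed.

Lemma mmap_congr_ideal n (R S : comNzRingType) (f : {rmorphism R -> S}) J
    (h1 h2 : 'I_n -> S) (p : {mpoly R[n]}) :
  is_ideal J -> (forall i, J (h1 i - h2 i)) -> J (mmap f h1 p - mmap f h2 p).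
Proof.
move=> idJ Jh.
have JM x1 x2 y1 y2 : J (x1 - x2) -> J (y1 - y2) -> J (x1 * y1 - x2 * y2).
  move=> Jx Jy; have -> : x1 * y1 - x2 * y2 = (x1 - x2) * y1 + x2 * (y1 - y2).
    by rewrite mulrBl mulrBr addrA subrK.
  by apply: idealD => //; [exact: ideal_mulr | exact: ideal_mull].
rewrite /mmap -sumrB; apply: ideal_sum => // m _; rewrite -mulrBr.
apply: ideal_mull => //; rewrite /mmap1.
elim/big_ind2: _ => [|x1 x2 y1 y2|i _]; last 1 first.
- elim: (m i) => [|e IHe]; first by rewrite subrr; apply: ideal0.
  by rewrite !exprS; apply: JM.
- by rewrite subrr; apply: ideal0.
- exact: JM.
Qed.

Lemma homog_ind n (R : comNzRingType) d (K : {mpoly R[n]} -> Prop) :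
  K 0 -> (forall p q, K p -> K q -> K (p + q)) ->
  (forall c m, mdeg m = d -> K (c *: 'X_[m])) ->
  forall p, p \is d.-homog -> K p.
Proof.
move=> K0 KD KX p /dhomogP hp; rewrite [p]mpolyE.
rewrite big_seq; elim/big_ind: _ => // m mp; apply: KX; exact: hp.
Qed.

Lemma homog_pihomog_sum n (R : comNzRingType) (p : {mpoly R[n]}) :
  p = \sum_(d < msize p) pihomog mdeg d p.
Proof. by apply: pihomog_partitionE. Qed.

Lemma homog_comp n l (R : comNzRingType) d (h : n.-tuple {mpoly R[l]}) p :
  (forall i, tnth h i \is 1.-homog) -> p \is d.-homog -> p \mPo h \is d.-homog.
Proof.
move=> hh; elim/homog_ind: p / => [|p q hp hq|c m <-].
- by rewrite comp_mpoly0 dhomog0.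
- by rewrite comp_mpolyD; apply: dhomogD.
rewrite comp_mpolyZ dhomogZ // comp_mpolyX mdegE.
elim/big_ind2: _ => [|d1 p1 d2 p2|i _]; first exact: dhomog1.
  by move=> *; apply: dhomogM.
by have := dhomogMn (m i) (hh i); rewrite mul1n.
Qed.

Lemma homog_map n (R S : comNzRingType) (f : {additive R -> S}) d
    (p : {mpoly R[n]}) : p \is d.-homog -> map_mpoly f p \is d.-homog.
Proof.
move=> hp; apply/dhomogP => m; rewrite mcoeff_msupp mcoeff_map_mpoly => nz.
apply/eqP; apply: contraNT nz => /(dhomog_nemf_coeff hp) ->.
by rewrite raddf0.
Qed.

Lemma meval_homogZ n (R : comNzRingType) d (p : {mpoly R[n]}) (v : 'I_n -> R) a :
  p \is d.-homog -> p.@[fun i => a * v i] = a ^+ d * p.@[v].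
Proof.
elim/homog_ind: p / => [|p q hp hq|c m <-].
- by rewrite !meval0 mulr0.
- by rewrite !mevalD hp hq mulrDr.
rewrite !mevalZ !mevalX mulrCA; congr (_ * _).
rewrite mdegE expr_sum -big_split /=.
by apply: eq_bigr => i _; rewrite exprMn.
Qed.

Lemma comp_homogZ n (R : comNzRingType) d (p : {mpoly R[n]}) a :
  p \is d.-homog -> p \mPo [tuple a *: 'X_i | i < n] = a ^+ d *: p.
Proof.
elim/homog_ind: p / => [|p q hp hq|c m <-].
- by rewrite comp_mpoly0 scaler0.
- by rewrite comp_mpolyD hp hq scalerDr.
rewrite comp_mpolyZ comp_mpolyX scalerA mulrC -scalerA; congr (_ *: _).
rewrite mpolyXE_id mdegE expr_sum -scaler_prod.
by apply: eq_bigr => i _; rewrite tnth_mktuple exprZn.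
Qed.

(** * Rees equations and bounds on the relation type *)

Section ReesEquations.
Variable R : comNzRingType.

Lemma rees_map_homog s (f : 'I_s -> R) d p :
  p \is d.-homog -> rees_map f p = p.@[f] *: 'X^d.
Proof.
rewrite /rees_map; elim/homog_ind: p / => [|p q hp hq|c m <-].
- by rewrite mmap0 meval0 scale0r.
- by rewrite mmapD mevalD scalerDl hp hq.
rewrite mmapZ mmapX mevalZ mevalX mul_polyC -scalerA; congr (_ *: _).
rewrite /mmap1 mdegE expr_sum -scaler_prod.
by apply: eq_bigr => i _; rewrite exprZn.
Qed.

Lemma rees_map_sum s (f : 'I_s -> R) p :
  rees_map f p = \sum_(d < msize p) (pihomog mdeg d p).@[f] *: 'X^d.
Proof.
rewrite {1}[p]homog_pihomog_sum /rees_map raddf_sum; apply: eq_bigr => d _.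
by rewrite -(rees_map_homog f (pihomogP mdeg d p)).
Qed.

Lemma rees_equationsP s (f : 'I_s -> R) p :
  rees_equations f p <-> forall d, (pihomog mdeg d p).@[f] = 0.
Proof.
rewrite /rees_equations /= rees_map_sum; split=> [h0 d|h0]; last first.
  by rewrite big1 // => i _; rewrite h0 scale0r.
have [ltd|led] := ltnP d (msize p); last first.
  suff -> : pihomog mdeg d p = 0 by rewrite meval0.
  rewrite pihomogE big_seq_cond big1 // => m /andP[mp /eqP dm].
  by have := msize_mdeg_lt mp; rewrite dm ltnNge led.
have := congr1 (fun q : {poly R} => q`_d) h0.
rewrite coef0 coef_sum (bigD1 (Ordinal ltd)) //= coefZ coefXn eqxx mulr1.
rewrite big1 ?addr0 // => i ne; rewrite coefZ coefXn.
case: eqP => [e|]; last by rewrite mulr0.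
by case/eqP: ne; apply: val_inj.
Qed.

Lemma rees_equations_homog s (f : 'I_s -> R) d p : p \is d.-homog ->
  rees_equations f p <-> p.@[f] = 0.
Proof.
move=> hp; rewrite /rees_equations /= (rees_map_homog f hp); split.
  by move/(congr1 (fun q : {poly R} => q`_d)); rewrite coefZ coefXn eqxx mulr1 coef0.
by move=> ->; rewrite scale0r.
Qed.

Definition homog_rees s (f : 'I_s -> R) N : set {mpoly R[s]} :=
  [set p | rees_equations f p /\ exists2 d, (d <= N)%N & p \is d.-homog].

Lemma rees_equations_ideal s (f : 'I_s -> R) : is_ideal (rees_equations f).
Proof.
rewrite /rees_equations; split=> [|p q /= hp hq|a p /= hp]; rewrite /= /rees_map.
- by rewrite raddf0.
- by rewrite raddfD /= -!/(rees_map f _) hp hq addr0.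
- by rewrite rmorphM /= -!/(rees_map f _) hp mulr0.
Qed.

Lemma homog_rees_sub s (f : 'I_s -> R) N :
  ideal_gen (homog_rees f N) `<=` rees_equations f.
Proof.
by apply: ideal_gen_min; [exact: rees_equations_ideal | move=> p []].
Qed.

(** The ideal of Rees equations is graded, so only its forms have to be checked. *)
Lemma generated_in_degree_leP s (f : 'I_s -> R) N :
  generated_in_degree_le (rees_equations f) N <->
  forall d p, p \is d.-homog -> p.@[f] = 0 -> ideal_gen (homog_rees f N) p.
Proof.
split=> [gen d p hp p0|gen].
  by rewrite -[homog_rees f N]/[set p | _] -gen; apply/(rees_equations_homog f hp).
apply/seteqP; split; last exact: homog_rees_sub.
move=> p /rees_equationsP p0; rewrite [p]homog_pihomog_sum.
apply: ideal_sum => [|d _]; first exact: ideal_gen_ideal.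
exact: gen (pihomogP _ _ _) (p0 d).
Qed.

(** Generation in degree at most [N] after inverting [a], with denominators cleared so that no
    localized ring is needed; the exponent depends on [p]. *)
Definition generated_at (a : R) s (f : 'I_s -> R) N :=
  forall d p, p \is d.-homog -> p.@[f] = 0 ->
    exists m, ideal_gen (homog_rees f N) (a ^+ m *: p).

(** Substituting linear forms with values [a f_i] multiplies the value of a form of degree [d] by
    [a ^ d], so a zero value stays zero. *)
Lemma homog_rees_comp s s' (f : 'I_s -> R) (f' : 'I_s' -> R) a
    (h : s.-tuple {mpoly R[s']}) :
  (forall i, tnth h i \is 1.-homog) ->
  (forall i, (tnth h i).@[f'] = a * f i) ->
  forall d p, p \is d.-homog -> p.@[f] = 0 ->
    p \mPo h \is d.-homog /\ (p \mPo h).@[f'] = 0.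
Proof.
move=> h1 hf d p hp p0; split; first exact: homog_comp.
rewrite comp_mpoly_meval (meval_eq _ hf).
by rewrite (meval_homogZ _ _ hp) p0 mulr0.
Qed.

Lemma homog1_linear s (u : 'I_s -> R) :
  \sum_i u i *: ('X_i : {mpoly R[s]}) \is 1.-homog.
Proof. by apply: rpred_sum => i _; rewrite dhomogZ // dhomogX /= mdeg1. Qed.

Lemma meval_linear s (u f : 'I_s -> R) :
  (\sum_i u i *: ('X_i : {mpoly R[s]})).@[f] = \sum_i u i * f i.
Proof. by rewrite raddf_sum; apply: eq_bigr => i _; rewrite /= mevalZ mevalXU. Qed.

(* Substituting [a f'_j = sum_i u_ji f_i] back and forth turns [t'_j] into a   *)
(* linear form congruent to [a ^ 2 t'_j] modulo the linear Rees equations.     *)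
Lemma generated_at_transfer s s' (f : 'I_s -> R) (f' : 'I_s' -> R) N a
    (u : 'I_s' -> 'I_s -> R) (v : 'I_s -> 'I_s' -> R) : (1 <= N)%N ->
  (forall j, a * f' j = \sum_i u j i * f i) ->
  (forall i, a * f i = \sum_j v i j * f' j) ->
  generated_at a f N -> generated_at a f' N.
Proof.
move=> N1 hu hv gen d p hp p0.
pose b := [tuple \sum_i u j i *: ('X_i : {mpoly R[s]}) | j < s'].
pose c := [tuple \sum_j v i j *: ('X_j : {mpoly R[s']}) | i < s].
have b1 j : tnth b j \is 1.-homog by rewrite tnth_mktuple homog1_linear.
have c1 i : tnth c i \is 1.-homog by rewrite tnth_mktuple homog1_linear.
have bf j : (tnth b j).@[f] = a * f' j by rewrite tnth_mktuple meval_linear hu.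
have cf i : (tnth c i).@[f'] = a * f i by rewrite tnth_mktuple meval_linear hv.
have [hbp bp0] := homog_rees_comp b1 bf hp p0.
have [m Gm] := gen _ _ hbp bp0.
(* [m] comes from the hypothesis on [f]; the other [2 d] from replacing each [t'_j] by [a ^ 2 t'_j]
   in a form of degree [d]. *)
exists (m + d + d)%N.
have idG := ideal_gen_ideal (homog_rees f' N).
have Gm' : ideal_gen (homog_rees f' N) (a ^+ m *: ((p \mPo b) \mPo c)).
  rewrite -comp_mpolyZ; apply: (ideal_gen_map (A := homog_rees f N)) => // q.
  move=> [/= qL [e eN hq]]; apply: sub_ideal_gen.
  move/(rees_equations_homog f hq): qL => q0.
  have [hq' q0'] := homog_rees_comp c1 cf hq q0.
  by split; [apply/(rees_equations_homog f' hq') | exists e].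
have bcE : (p \mPo b) \mPo c = p \mPo [tuple (tnth b j) \mPo c | j < s'].
  rewrite /comp_mpoly rmorph_mmap; apply: eq_mmap => [x /=|j /=].
    by rewrite -/(comp_mpoly c _) comp_mpolyC.
  by rewrite tnth_mktuple.
have cong : ideal_gen (homog_rees f' N)
    ((p \mPo b) \mPo c - (p \mPo [tuple (a ^+ 2) *: 'X_j | j < s'])).
  rewrite bcE /comp_mpoly; apply: (@mmap_congr_ideal _ _ _ (@mpolyC s' R) _ _ _ _ idG) => j.
  rewrite !tnth_mktuple; apply: sub_ideal_gen.
  have h1 : ((\sum_i u j i *: 'X_i) \mPo c) - a ^+ 2 *: 'X_j \is 1.-homog.
    apply: rpredB; first exact: homog_comp c1 (homog1_linear _).
    by rewrite dhomogZ // dhomogX /= mdeg1.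
  split; last by exists 1%N.
  apply/(rees_equations_homog f' h1); rewrite mevalB comp_mpoly_meval.
  rewrite (meval_eq _ cf) mevalZ mevalXU meval_linear.
  under eq_bigr do rewrite mulrCA.
  by rewrite -mulr_sumr -hu mulrA subrr.
rewrite (comp_homogZ _ hp) -exprM mul2n -addnn in cong.
rewrite -addnA exprD -scalerA.
set X := (p \mPo b) \mPo c in Gm' cong; set Y := a ^+ (d + d) *: p in cong *.
have -> : a ^+ m *: Y = a ^+ m *: X - a ^+ m *: (X - Y).
  by rewrite scalerBr opprB addrC subrK.
by apply: idealB => //; rewrite -mul_mpolyC; apply: ideal_mull.
Qed.

(** The two inclusions say that the ideals agree once [a] is inverted, so their equations there have
    the same generation degrees. *)
Lemma generated_at_ideal s s' (f : 'I_s -> R) (f' : 'I_s' -> R) N a :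
  (1 <= N)%N ->
  (forall x, ideal_gen (range f) x -> ideal_gen (range f') (a * x)) ->
  (forall x, ideal_gen (range f') x -> ideal_gen (range f) (a * x)) ->
  generated_at a f N -> generated_at a f' N.
Proof.
move=> N1 aff' af'f.
have /choice[u hu] : forall j, exists u, a * f' j = \sum_i u i * f i.
  by move=> j; apply/ideal_gen_rangeP/af'f/mem_range_ideal_gen.
have /choice[v hv] : forall i, exists v, a * f i = \sum_j v j * f' j.
  by move=> i; apply/ideal_gen_rangeP/aff'/mem_range_ideal_gen.
exact: (generated_at_transfer N1 hu hv).
Qed.

Lemma generated_at1 s (f : 'I_s -> R) N :
  generated_at 1 f N <-> generated_in_degree_le (rees_equations f) N.
Proof.
rewrite generated_in_degree_leP; split=> gen d p hp p0.
  by have [m] := gen d p hp p0; rewrite expr1n scale1r.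
by exists 0%N; rewrite expr0 scale1r; apply: gen hp p0.
Qed.

(** Local-global principle for the cover by the loci where [a] or [b] is invertible. *)
Lemma generated_at_comaximal s (f : 'I_s -> R) N a b : a + b = 1 ->
  generated_at a f N -> generated_at b f N ->
  generated_in_degree_le (rees_equations f) N.
Proof.
move=> ab1 ga gb; apply/generated_in_degree_leP => d p hp p0.
have [m] := ga d p hp p0; have [l] := gb d p hp p0.
rewrite -!mul_mpolyC !rmorphXn /= => Gb Ga.
apply: (ideal_pow_split _ _ Ga Gb); first exact: ideal_gen_ideal.
by rewrite -mpolyCD ab1.
Qed.

Lemma generated_at_weaken s (f : 'I_s -> R) N a :
  generated_in_degree_le (rees_equations f) N -> generated_at a f N.
Proof.
move/generated_in_degree_leP=> gen d p hp p0; exists 0%N.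
by rewrite scale1r; apply: gen hp p0.
Qed.

(** One generating family suffices here, by [rt_leP]; upper bounds pass between ideals more easily
    than the least value does. *)
Definition rt_le (I : set R) N := exists s (f : 'I_s -> R),
  I = ideal_gen (range f) /\ generated_in_degree_le (rees_equations f) N.

Definition fin_gen (I : set R) := exists s (f : 'I_s -> R),
  I = ideal_gen (range f).

(** Independence of the generating family: [generated_at_ideal] with [a = 1]. *)
Lemma rt_leP I N s (f : 'I_s -> R) : (1 <= N)%N -> I = ideal_gen (range f) ->
  rt_le I N <-> generated_in_degree_le (rees_equations f) N.
Proof.
move=> N1 If; split=> [[s' [f' [If']]]|gen]; last by exists s, f.
move/generated_at1=> gen; apply/generated_at1; apply: generated_at_ideal gen => //.
  by move=> x; rewrite mul1r -If -If'.
by move=> x; rewrite mul1r -If -If'.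
Qed.

Lemma rt_le_mono I N M : (N <= M)%N -> rt_le I N -> rt_le I M.
Proof.
move=> NM [s [f [If gen]]]; exists s, f; split=> //; apply/generated_in_degree_leP.
move=> d p hp p0; move/generated_in_degree_leP: gen => /(_ d p hp p0).
apply: ideal_gen_min; first exact: ideal_gen_ideal.
move=> q [qL [e eN hq]]; apply: sub_ideal_gen; split=> //.
by exists e => //; apply: leq_trans NM.
Qed.

Lemma relation_typeP I N : relation_type I N <->
  [/\ (1 <= N)%N, rt_le I N & forall M, (1 <= M)%N -> rt_le I M -> (N <= M)%N].
Proof.
split=> [[[s [f If]] all]|[N1 rtN Nmin]].
  have [N1 gen Nmin] := all s f If; split=> //; first by exists s, f.
  by move=> M M1 /(rt_leP M1 If); apply: Nmin.
split; first by have [s [f [If _]]] := rtN; exists s, f.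
move=> s f If; split=> //; first exact/(rt_leP N1 If).
by move=> M M1 /(rt_leP M1 If); apply: Nmin.
Qed.

Lemma rt_le_relation_type I N : rt_le I N -> exists M, relation_type I M.
Proof.
move=> rtN; have ex : exists M, (1 <= M)%N && `[<rt_le I M>].
  (* The bound [N] may be 0, whereas a relation type is at least 1. *)
  exists N.+1; apply/andP; split=> //; apply/asboolP.
  exact: rt_le_mono (leqnSn N) rtN.
have [M /andP[M1 /asboolP rtM] Mmin] := ex_minnP ex.
exists M; apply/relation_typeP; split=> // M' M'1 rtM'; apply: Mmin.
by rewrite M'1; apply/asboolP.
Qed.

Lemma relation_type_transfer I J N :
  (forall M, (1 <= M)%N -> rt_le I M <-> rt_le J M) ->
  relation_type I N -> relation_type J N.
Proof.
move=> IJ /relation_typeP[N1 rtN Nmin]; apply/relation_typeP; split=> //.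
  exact/IJ.
by move=> M M1 /(IJ M M1); apply: Nmin.
Qed.

(** One variable has a single monomial in each degree, so a form is determined by its value at 1. *)
Lemma rees_equations_unit (f : 'I_1 -> R) d p : f ord0 = 1 ->
  p \is d.-homog -> p.@[f] = 0 -> p = 0.
Proof.
move=> f1 hp p0; apply/mpolyP => m; rewrite mcoeff0.
have [dm|dm] := eqVneq (mdeg m) d; last exact: dhomog_nemf_coeff hp dm.
suff : p = p.@[f] *: 'X_[m] by rewrite p0 scale0r => ->; rewrite mcoeff0.
elim/homog_ind: p / hp {p0} => [|p q hp hq|c l dl].
- by rewrite meval0 scale0r.
- by rewrite mevalD scalerDl -hp -hq.
have -> : l = m.
  apply/mnmP => i; move: dm; rewrite -dl !mdegE !big_ord_recl !big_ord0 !addn0.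
  by rewrite (ord1 i).
by rewrite mevalZ mevalX big_ord_recl big_ord0 f1 expr1n !mulr1.
Qed.

Lemma unit_family_gen : ideal_gen (range (fun _ : 'I_1 => 1 : R)) = setT.
Proof.
apply: ideal_setT; first exact: ideal_gen_ideal.
exact: mem_range_ideal_gen (fun _ : 'I_1 => 1 : R) ord0.
Qed.

Lemma generated_unit_family N :
  generated_in_degree_le (rees_equations (fun _ : 'I_1 => 1 : R)) N.
Proof.
apply/generated_in_degree_leP => d p hp p0.
rewrite (rees_equations_unit _ hp p0) //; apply: ideal0.
exact: ideal_gen_ideal.
Qed.

Lemma rt_le_setT N : rt_le [set: R] N.
Proof.
exists 1%N, (fun=> 1); split; first by rewrite unit_family_gen.
exact: generated_unit_family.
Qed.

(** Inverting an element of the ideal makes the ideal improper, and the family [1] has no nonzero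
    equations. *)
Lemma generated_at_mem s (f : 'I_s -> R) N a : (1 <= N)%N ->
  ideal_gen (range f) a -> generated_at a f N.
Proof.
move=> N1 fa.
apply: (@generated_at_ideal _ _ (fun _ : 'I_1 => 1)) => //.
- by move=> x _; apply: ideal_mulr => //; apply: ideal_gen_ideal.
- by move=> x _; rewrite unit_family_gen.
- exact/generated_at_weaken/generated_unit_family.
Qed.

(** Where [a] is invertible, [I] becomes improper and the intersection agrees with [J]; where [b] is
    invertible, the roles are exchanged. *)
Lemma rt_le_comaximal I J N a b : (1 <= N)%N -> I a -> J b -> a + b = 1 ->
  fin_gen I -> fin_gen J -> fin_gen (I `&` J) ->
  rt_le (I `&` J) N <-> rt_le I N /\ rt_le J N.
Proof.
move=> N1 Ia Jb ab1 [s [f If]] [s' [g Jg]] [l [h IJh]].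
rewrite (rt_leP N1 If) (rt_leP N1 Jg) (rt_leP N1 IJh).
have idI : is_ideal I by rewrite If; apply: ideal_gen_ideal.
have idJ : is_ideal J by rewrite Jg; apply: ideal_gen_ideal.
have bI x : I x -> (I `&` J) (b * x) by split; [apply: ideal_mull|apply: ideal_mulr].
have aJ x : J x -> (I `&` J) (a * x) by split; [apply: ideal_mulr|apply: ideal_mull].
split=> [gen|[genI genJ]]; first split.
- apply: (generated_at_comaximal ab1); first by apply: generated_at_mem => //; rewrite -If.
  apply: (@generated_at_ideal _ _ h) ; rewrite -?IJh -?If //.
    by move=> x [Ix _]; apply: ideal_mull.
  exact: generated_at_weaken.
- apply: (generated_at_comaximal ab1); last by apply: generated_at_mem => //; rewrite -Jg.
  apply: (@generated_at_ideal _ _ h) ; rewrite -?IJh -?Jg //.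
    by move=> x [_ Jx]; apply: ideal_mull.
  exact: generated_at_weaken.
- apply: (generated_at_comaximal ab1).
    apply: (@generated_at_ideal _ _ g) ; rewrite -?IJh -?Jg //.
      by move=> x [_ Jx]; apply: ideal_mull.
    exact: generated_at_weaken.
  apply: (@generated_at_ideal _ _ f) ; rewrite -?IJh -?If //.
    by move=> x [Ix _]; apply: ideal_mull.
  exact: generated_at_weaken.
Qed.

End ReesEquations.

(** Scaling multiplies the value of a form of degree [d] by [a ^ d], which is cancellable. *)
Lemma rees_equations_scale (R : idomainType) s (f : 'I_s -> R) a : a != 0 ->
  rees_equations (fun i => a * f i) = rees_equations f.
Proof.
move=> a0; apply/seteqP; split=> p /rees_equationsP hp; apply/rees_equationsP => d;
  move/(_ d): hp; rewrite (meval_homogZ _ _ (pihomogP _ _ _)).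
  by move/eqP; rewrite mulf_eq0 expf_eq0 (negbTE a0) andbF => /eqP.
by move=> ->; rewrite mulr0.
Qed.

Lemma rt_le_scale (R : idomainType) (J : set R) a N : (1 <= N)%N -> a != 0 ->
  fin_gen J -> rt_le [set a * x | x in J] N <-> rt_le J N.
Proof.
move=> N1 a0 [s [f Jf]]; rewrite (rt_leP N1 Jf).
have aJ : [set a * x | x in J] = ideal_gen (range (fun i => a * f i)).
  apply/seteqP; split=> [_ [x + <-]|x].
    rewrite Jf => /ideal_gen_rangeP[c ->]; apply/ideal_gen_rangeP; exists c.
    by rewrite mulr_sumr; apply: eq_bigr => i _; rewrite mulrCA.
  move=> /ideal_gen_rangeP[c ->]; exists (\sum_i c i * f i).
    by rewrite Jf; apply/ideal_gen_rangeP; exists c.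
  by rewrite mulr_sumr; apply: eq_bigr => i _; rewrite mulrCA.
by rewrite (rt_leP N1 aJ) rees_equations_scale.
Qed.

Lemma meval_map_mpoly n (R S : comNzRingType) (phi : {rmorphism R -> S})
    (v : 'I_n -> R) (p : {mpoly R[n]}) :
  (map_mpoly phi p).@[phi \o v] = phi p.@[v].
Proof.
rewrite /meval /map_mpoly !rmorph_mmap; apply: eq_mmap => [x|i] /=.
  by rewrite mmapC.
by rewrite mmapX mmap1U.
Qed.

Lemma homog_rees_map (R S : comNzRingType) (phi : {rmorphism R -> S}) s
    (f : 'I_s -> R) N p :
  ideal_gen (homog_rees f N) p ->
  ideal_gen (homog_rees (phi \o f) N) (map_mpoly phi p).
Proof.
apply: ideal_gen_map => q [qL [d dN hq]]; apply: sub_ideal_gen; split.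
  apply/(rees_equations_homog _ (homog_map _ hq)).
  by rewrite meval_map_mpoly (rees_equations_homog f hq).1 // rmorph0.
by exists d => //; apply: homog_map.
Qed.

Lemma rt_le_iso (R S : comNzRingType) (phi : {rmorphism R -> S})
    (psi : {rmorphism S -> R}) (I : set R) N :
  cancel phi psi -> cancel psi phi -> rt_le I N -> rt_le (psi @^-1` I) N.
Proof.
move=> phiK psiK [s [f [If gen]]]; exists s, (phi \o f); split.
  apply/seteqP; split=> y.
    rewrite /= If => /ideal_gen_rangeP[c hc]; rewrite -[y]psiK hc rmorph_sum.
    apply/ideal_gen_rangeP; exists (phi \o c).
    by apply: eq_bigr => i _; rewrite rmorphM.
  move=> /ideal_gen_rangeP[c ->]; rewrite /= If rmorph_sum.
  apply/ideal_gen_rangeP; exists (psi \o c).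
  by apply: eq_bigr => i _; rewrite rmorphM /= phiK.
apply/generated_in_degree_leP => d p hp p0.
have -> : p = map_mpoly phi (map_mpoly psi p).
  by apply/mpolyP => m; rewrite !mcoeff_map_mpoly /= psiK.
apply: homog_rees_map; move/generated_in_degree_leP: gen; apply.
  exact: homog_map hp.
rewrite -[RHS](rmorph0 psi) -p0 -meval_map_mpoly; apply: meval_eq => i /=.
by rewrite phiK.
Qed.

(** * Adjoining a regular element *)

Lemma mwidenE_mmap n (R : nzRingType) (p : {mpoly R[n]}) :
  mwiden p = mmap (@mpolyC n.+1 R) (fun i => 'X_(widen_ord (leqnSn n) i)) p.
Proof. by []. Qed.

Section FormValues.
Variables (R : comNzRingType) (s : nat) (f : 'I_s -> R).

(* This is the [j]-th power of the ideal generated by [f]. *)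
Definition form_values j : set R :=
  [set y | exists2 p : {mpoly R[s]}, p \is j.-homog & y = p.@[f]].

Lemma form_values_ideal j : is_ideal (form_values j).
Proof.
split.
- by exists 0; rewrite ?dhomog0 // meval0.
- move=> _ _ [p hp ->] [q hq ->]; exists (p + q); last by rewrite mevalD.
  exact: dhomogD.
- by move=> a _ [p hp ->]; exists (a *: p); rewrite ?dhomogZ // mevalZ.
Qed.

Lemma homog_splitX j (p : {mpoly R[s]}) : p \is j.+1.-homog ->
  exists2 q : 'I_s -> {mpoly R[s]},
    forall l, q l \is j.-homog & p = \sum_l 'X_l * q l.
Proof.
elim/homog_ind: p / => [|p p' [q hq ->] [q' hq' ->]|c m dm].
- exists (fun=> 0); first by move=> l; rewrite dhomog0.
  by rewrite big1 // => l _; rewrite mulr0.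
- exists (fun l => q l + q' l); first by move=> l; apply: dhomogD.
  by rewrite -big_split; apply: eq_bigr => l _; rewrite mulrDr.
have [l ml] : exists l, m l != 0%N.
  apply/existsP; rewrite -[[exists _, _]]negbK negb_exists; apply/negP => /forallP m0.
  suff : mdeg m = 0%N by rewrite dm.
  by rewrite mdegE big1 // => i _; apply/eqP; have := m0 i; rewrite negbK.
have lm : (U_(l) <= m)%MM by rewrite lep1mP.
exists (fun i => if i == l then c *: 'X_[m - U_(l)] else 0).
  move=> i; case: eqP => _; last exact: dhomog0.
  rewrite dhomogZ // dhomogX /=; apply/eqP.
  by have := congr1 mdeg (submK lm); rewrite mdegD mdeg1 dm addn1 => -[].
rewrite (bigD1 l) //= eqxx big1 ?addr0 => [|i /negbTE ->]; last by rewrite mulr0.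
by rewrite -scalerAr -mpolyXD addmC submK.
Qed.

Lemma form_values_leS j : form_values j.+1 `<=` form_values j.
Proof.
move=> _ [p /homog_splitX[q hq ->] ->]; rewrite raddf_sum /=.
apply: ideal_sum => [|l _]; first exact: form_values_ideal.
rewrite mevalM; apply: ideal_mull; first exact: form_values_ideal.
by exists (q l).
Qed.

Lemma form_values_le i j : (i <= j)%N -> form_values j `<=` form_values i.
Proof.
elim: j => [|j IHj]; first by rewrite leqn0 => /eqP ->.
rewrite leq_eqVlt => /predU1P[-> //|]; rewrite ltnS => /IHj ij.
by move=> y /form_values_leS/ij.
Qed.

End FormValues.

Section AdjoinRegular.
Variables (R : comNzRingType) (s : nat) (f : 'I_s -> R) (g : R).

Definition adjoin_family (i : 'I_s.+1) : R :=
  if unlift ord_max i is Some j then f j else g.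

Lemma adjoin_family_widen j : adjoin_family (widen_ord (leqnSn s) j) = f j.
Proof.
by rewrite -lift_max_widen /adjoin_family liftK.
Qed.

Lemma adjoin_family_max : adjoin_family ord_max = g.
Proof. by rewrite /adjoin_family unlift_none. Qed.

Lemma meval_mwiden p : (mwiden p).@[adjoin_family] = p.@[f].
Proof.
rewrite mwidenE_mmap /meval rmorph_mmap; apply: eq_mmap => [x|i] /=.
  by rewrite mmapC.
by rewrite mmapX mmap1U adjoin_family_widen.
Qed.

Lemma homog_mwiden d (p : {mpoly R[s]}) : p \is d.-homog -> mwiden p \is d.-homog.
Proof.
elim/homog_ind: p / => [|p q hp hq|c m <-]; first by rewrite mwiden0 dhomog0.
  by rewrite mwidenD; apply: dhomogD.
rewrite mwidenZ mwidenX dhomogZ // dhomogX /= !mdegE big_ord_recr /=.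
rewrite mnmwiden_ordmax addn0; apply/eqP; apply: eq_bigr => i _.
by rewrite mnmwiden_widen.
Qed.

Local Notation Y := ('X_ord_max : {mpoly R[s.+1]}).

Lemma homog_splitY d (p : {mpoly R[s.+1]}) : p \is d.-homog ->
  exists2 q : nat -> {mpoly R[s]},
    forall i, (i <= d)%N -> q i \is (d - i).-homog &
    p = \sum_(i < d.+1) mwiden (q i) * Y ^+ i.
Proof.
elim/homog_ind: p / => [|p p' [q hq ->] [q' hq' ->]|c m dm].
- exists (fun=> 0); first by move=> i _; rewrite dhomog0.
  by rewrite big1 // => i _; rewrite mwiden0 mul0r.
- exists (fun i => q i + q' i).
    by move=> i id; apply: dhomogD; [apply: hq | apply: hq'].
  by rewrite -big_split; apply: eq_bigr => i _; rewrite mwidenD mulrDl.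
pose m' := [multinom m (widen_ord (leqnSn s) i) | i < s].
have dm' : (mdeg m' + m ord_max)%N = d.
  rewrite -dm !mdegE big_ord_recr /=; congr (_ + _)%N.
  by apply: eq_bigr => i _; rewrite mnmE.
have md : (m ord_max < d.+1)%N by rewrite ltnS -dm' leq_addl.
exists (fun i => if i == m ord_max then c *: 'X_[m'] else 0).
  move=> i _; case: eqP => [->|_]; last exact: dhomog0.
  by rewrite dhomogZ // dhomogX /= -dm' addnK.
rewrite (bigD1 (Ordinal md)) //= eqxx big1 ?addr0; last first.
  move=> i ne; rewrite ifN ?mwiden0 ?mul0r //.
rewrite mwidenZ mwidenX -scalerAl mpolyXn -mpolyXD; congr (_ *: 'X_[_]).
apply/mnmP => i; rewrite mnmDE mulmnE mnm1E.
have [j ->|->] := unliftP ord_max i; last first.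
  by rewrite mnmwiden_ordmax eqxx mul1n.
rewrite lift_max_widen mnmwiden_widen mnmE -val_eqE /= [s == j]gtn_eqF ?ltn_ord //.
by rewrite mul0n addn0.
Qed.

Lemma homog_rees_mwiden N p :
  ideal_gen (homog_rees f N) p ->
  ideal_gen (homog_rees adjoin_family N) (mwiden p).
Proof.
apply: ideal_gen_map => q [qL [d dN hq]]; apply: sub_ideal_gen; split.
  apply/(rees_equations_homog _ (homog_mwiden hq)); rewrite meval_mwiden.
  exact/(rees_equations_homog f hq).
by exists d => //; apply: homog_mwiden.
Qed.

(* In an equation of degree [e], the coefficient [F] of the top power          *)
(* [Y ^ (d + 1)] has degree [e - d - 1] and [g ^ (d + 1) F(f) \in (f) ^ (e - d)]. *)
(* Regularity lets one rewrite [F] as [sum_l f_l H_l], and [f_l Y = g X_l]     *)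
(* lowers the degree in [Y].                                                   *)
Lemma generated_adjoin :
  (forall j y, form_values f j (g * y) -> form_values f j y) ->
  generated_in_degree_le (rees_equations f) 1 ->
  generated_in_degree_le (rees_equations adjoin_family) 1.
Proof.
move=> reg /generated_in_degree_leP gen; apply/generated_in_degree_leP => e p hp.
have {p hp} [q hq ->] := homog_splitY hp.
have idG := ideal_gen_ideal (homog_rees adjoin_family 1).
(* The bound [d] on the degree in [Y] is separated from the total degree [e], which stays fixed in
   the induction. *)
suff key d : (d <= e)%N -> forall q : nat -> {mpoly R[s]},
    (forall i, (i <= e)%N -> q i \is (e - i).-homog) ->
    \sum_(i < d.+1) (q i).@[f] * g ^+ i = 0 ->
    ideal_gen (homog_rees adjoin_family 1) (\sum_(i < d.+1) mwiden (q i) * Y ^+ i).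
  rewrite raddf_sum /= => q0; apply: key => //; rewrite -[RHS]q0.
  apply: eq_bigr => i _.
  by rewrite mevalM meval_mwiden rmorphXn /= mevalXU adjoin_family_max.
elim: d {q hq} => [|d IHd] de q hq.
  rewrite !big_ord1 !expr0 !mulr1 => q0.
  by apply: homog_rees_mwiden; apply: (gen e) q0; have := hq 0%N isT; rewrite subn0.
rewrite big_ord_recr /= => q0.
have [H hH qH] : form_values f (e - d) (q d.+1).@[f].
  have regn n : forall y, form_values f (e - d) (g ^+ n * y) ->
      form_values f (e - d) y.
    elim: n => [|n IHn] y; first by rewrite mul1r.
    by rewrite exprS -mulrA => /reg/IHn.
  apply: (regn d.+1).
  have -> : g ^+ d.+1 * (q d.+1).@[f] = - \sum_(i < d.+1) (q i).@[f] * g ^+ i.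
    by apply/eqP; rewrite -addr_eq0 addrC [X in _ + X]mulrC q0.
  have idV := form_values_ideal f (e - d).
  apply: idealN => //; apply: ideal_sum => // i _; apply: ideal_mulr => //.
  have id : (i <= d)%N by rewrite -ltnS.
  apply: (@form_values_le _ _ _ (e - d) (e - i)); first exact: leq_sub2l.
  by exists (q i) => //; apply: hq; apply: leq_trans (leq_trans id (leqnSn d)) de.
have ed : (e - d = (e - d.+1).+1)%N by rewrite -subSn // subSS.
have [h hh defH] := homog_splitX (eq_ind _ (fun j => H \is j.-homog) hH _ ed).
(* As [H] and the top coefficient have the same value at [f], moving [g H] into the coefficient of
   [Y ^ d] keeps the total value zero. *)
pose q' i := if i == d then q d + g *: H else q i.
have hq' i : (i <= e)%N -> q' i \is (e - i).-homog.
  move=> ie; rewrite /q'; case: eqP => [->|_]; last exact: hq.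
  by apply: dhomogD; [apply: hq; apply: ltnW | rewrite dhomogZ].
have sumq' (V : comNzRingType) (phi : {mpoly R[s]} -> V) (y : V) :
    {morph phi : a b / a + b} ->
    \sum_(i < d.+1) phi (q' i) * y ^+ i =
    \sum_(i < d.+1) phi (q i) * y ^+ i + phi (g *: H) * y ^+ d.
  move=> phiD; rewrite !big_ord_recr /= {2}/q' eqxx phiD mulrDl addrA.
  congr (_ + _ + _); apply: eq_bigr => i _.
  by rewrite /q' ltn_eqF.
have q'0 : \sum_(i < d.+1) (q' i).@[f] * g ^+ i = 0.
  rewrite (sumq' _ (meval f)); last exact: mevalD.
  by rewrite mevalZ -qH mulrAC -exprS mulrC.
have := IHd (ltnW de) q' hq' q'0; rewrite (sumq' _ (@mwiden s R)); last exact: mwidenD.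
rewrite [\sum_(i < d.+2) _]big_ord_recr /= => G'.
(* [K] and [q d.+1] have the same value at [f], so they differ by an equation of [f]; [K Y] is
   congruent to [g H] modulo the linear equations [f_l Y - g X_l]. *)
pose K := \sum_l f l *: h l.
have hK : K \is (e - d.+1).-homog by apply: rpred_sum => l _; rewrite dhomogZ.
have GK : ideal_gen (homog_rees adjoin_family 1) (mwiden (q d.+1 - K)).
  apply: homog_rees_mwiden; apply: (gen (e - d.+1)%N).
    by apply: rpredB => //; apply: hq.
  rewrite mevalB qH defH /K !(raddf_sum (meval f)) -sumrB big1 //= => l _.
  by rewrite mevalM mevalXU mevalZ subrr.
have GKH : ideal_gen (homog_rees adjoin_family 1) (mwiden K * Y - mwiden (g *: H)).
  rewrite defH /K scaler_sumr !(raddf_sum (@mwiden s R)) /= mulr_suml -sumrB.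
  apply: ideal_sum => // l _.
  have -> : mwiden (f l *: h l) * Y - mwiden (g *: ('X_l * h l)) =
      mwiden (h l) * (f l *: Y - g *: mwiden 'X_l).
    rewrite !mwidenZ mwidenM mulrBr -!scalerAr -scalerAl; congr (_ - _ *: _).
    by rewrite mulrC.
  apply: ideal_mull => //; apply: sub_ideal_gen.
  have h1 : f l *: Y - g *: mwiden 'X_l \is 1.-homog.
    apply: rpredB; rewrite dhomogZ //; first by rewrite dhomogX /= mdeg1.
    by apply: homog_mwiden; rewrite dhomogX /= mdeg1.
  split; last by exists 1%N.
  apply/(rees_equations_homog _ h1).
  rewrite mevalB !mevalZ meval_mwiden !mevalXU adjoin_family_max.
  by rewrite mulrC subrr.
have -> : \sum_(i < d.+1) mwiden (q i) * Y ^+ i + mwiden (q d.+1) * Y ^+ d.+1 =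
    (\sum_(i < d.+1) mwiden (q i) * Y ^+ i + mwiden (g *: H) * Y ^+ d)
    + (Y ^+ d.+1 * mwiden (q d.+1 - K) + Y ^+ d * (mwiden K * Y - mwiden (g *: H))).
  by rewrite mwidenB exprSr; ring.
by apply: idealD => //; apply: idealD => //; apply: ideal_mull.
Qed.

End AdjoinRegular.

(** * Primes with algebraic residue field *)

Section LastVariable.
Variables (R : comNzRingType) (n : nat).

(** The inverse of [muni], with [X] sent to the last variable. *)
Definition of_uni (q : {poly {mpoly R[n]}}) : {mpoly R[n.+1]} :=
  (map_poly (@mwiden n R) q).['X_ord_max].

Fact of_uni_is_zmod_morphism : zmod_morphism of_uni.
Proof. by move=> p q; rewrite /of_uni rmorphB hornerD hornerN. Qed.

Fact of_uni_is_monoid_morphism : monoid_morphism of_uni.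
Proof.
by split=> [|p q]; rewrite /of_uni ?rmorph1 ?hornerC // rmorphM hornerM.
Qed.

HB.instance Definition _ := GRing.isZmodMorphism.Build
  {poly {mpoly R[n]}} {mpoly R[n.+1]} of_uni of_uni_is_zmod_morphism.
HB.instance Definition _ := GRing.isMonoidMorphism.Build
  {poly {mpoly R[n]}} {mpoly R[n.+1]} of_uni of_uni_is_monoid_morphism.

Lemma of_uniC p : of_uni p%:P = mwiden p.
Proof. by rewrite /of_uni map_polyC hornerC. Qed.

Lemma of_uniX : of_uni 'X = 'X_ord_max.
Proof. by rewrite /of_uni map_polyX hornerX. Qed.

Lemma muni_monom (m : 'X_{1..n.+1}) :
  muni ('X_[m] : {mpoly R[n.+1]}) =
    ('X_[[multinom m (widen_ord (leqnSn n) i) | i < n]])%:P * 'X^(m ord_max).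
Proof. by rewrite muniE msuppX big_seq1 mcoeffX eqxx scale1r mul_polyC. Qed.

Lemma muniK : cancel (@muni n R) of_uni.
Proof.
move=> p; rewrite [p]mpolyE (raddf_sum (@muni n R)) (raddf_sum of_uni); apply: eq_bigr => m _ /=.
rewrite muniZ muni_monom -mul_polyC !(rmorphM of_uni) /= !of_uniC mwidenC mul_mpolyC.
rewrite (rmorphXn of_uni) /= of_uniX mwidenX mpolyXn -mpolyXD; congr (_ *: 'X_[_]).
apply/mnmP => i; rewrite mnmDE mulmnE mnm1E.
have [j ->|->] := unliftP ord_max i; last by rewrite mnmwiden_ordmax eqxx mul1n.
rewrite lift_max_widen mnmwiden_widen mnmE -val_eqE /= [n == j]gtn_eqF ?ltn_ord //.
by rewrite mul0n addn0.
Qed.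

Lemma muni_mwiden (p : {mpoly R[n]}) : muni (mwiden p) = p%:P.
Proof.
rewrite [p]mpolyE (raddf_sum (@mwiden n R)) (raddf_sum (@muni n R)).
rewrite (raddf_sum polyC); apply: eq_bigr => m _ /=.
rewrite mwidenZ muniZ mwidenX muni_monom mnmwiden_ordmax mulr1 -mul_polyC -polyCM.
rewrite mul_mpolyC; congr (_ *: 'X_[_])%:P; apply/mnmP => i.
by rewrite mnmE mnmwiden_widen.
Qed.

Lemma of_uniK : cancel of_uni (@muni n R).
Proof.
move=> q; rewrite /of_uni -horner_map /= -map_poly_comp.
have -> : muni ('X_ord_max : {mpoly R[n.+1]}) = 'X.
  rewrite muni_monom mnm1E eqxx (_ : [multinom _ | _ < _] = 0%MM) ?mpolyX0 ?mul1r //.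
  by apply/mnmP => i; rewrite mnmE mnm1E mnm0E -val_eqE /= gtn_eqF.
rewrite (eq_map_poly muni_mwiden) -[RHS](comp_polyXr q) /comp_poly.
by congr (_.['X]).
Qed.

End LastVariable.

(** * Extension of scalars from [B] to [B[X]] *)

Section PolynomialExtension.
Variable B : comNzRingType.

(** A monic [g] is regular modulo [V[X]]: the leading coefficient of [y] is that of [g y], and the
    leading term can be stripped. *)
Lemma coef_ideal_monic (V : set B) (g y : {poly B}) : is_ideal V ->
  g \is monic -> (forall i, V (g * y)`_i) -> forall i, V y`_i.
Proof.
move=> idV mg; have [l ly] := ubnP (size y); elim: l => // l IHl in y ly *.
move=> Vgy; have [->|y0] := eqVneq y 0; first by move=> i; rewrite coef0; apply: ideal0.
have Vl : V (lead_coef y).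
  have := Vgy (size (g * y)).-1.
  by rewrite -[_`_ _]/(lead_coef _) lead_coef_monicM.
pose z := y - lead_coef y *: 'X^((size y).-1).
have zi i : z`_i = y`_i - lead_coef y * (i == (size y).-1)%:R.
  by rewrite coefB coefZ coefXn.
have Vz : forall i, V z`_i.
  apply: IHl => [|i].
    exact: leq_trans (size_drop_lead y0) _.
  rewrite /z mulrBr coefB; apply: idealB => //.
  by rewrite -scalerAr coefZ; apply: ideal_mulr.
move=> i; rewrite -[y`_i](subrK (lead_coef y * (i == (size y).-1)%:R)) -zi.
by apply: idealD => //; apply: ideal_mulr.
Qed.

Variables (s : nat) (f : 'I_s -> B).
Local Notation Cf := (polyC \o f).

Lemma coef_meval (p : {mpoly {poly B}[s]}) i :
  (p.@[Cf])`_i = (map_mpoly (coefp i) p).@[f].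
Proof.
rewrite [p]mpolyE (raddf_sum (meval Cf)) coef_sum (raddf_sum (map_mpoly (coefp i))).
rewrite (raddf_sum (meval f)); apply: eq_bigr => m _ /=.
rewrite mevalZ mevalX.
have -> : \prod_j Cf j ^+ m j = (\prod_j f j ^+ m j)%:P.
  by rewrite rmorph_prod; apply: eq_bigr => j _; rewrite rmorphXn.
rewrite coefMC.
have -> : map_mpoly (coefp i) (p@_m *: 'X_[m]) = (p@_m)`_i *: 'X_[m].
  by apply/mpolyP => l; rewrite mcoeff_map_mpoly !mcoeffZ !mcoeffX /= mulr_natr coefMn mulr_natr.
by rewrite mevalZ mevalX.
Qed.

(** Powers of the extended ideal are read off coefficientwise; this reduces regularity of a monic
    polynomial to [coef_ideal_monic]. *)
Lemma form_values_polyC j y :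
  form_values Cf j y <-> forall i, form_values f j y`_i.
Proof.
split=> [[p hp ->] i|Vy].
  by exists (map_mpoly (coefp i) p); [exact: homog_map | exact: coef_meval].
rewrite -[y]coefK poly_def; apply: ideal_sum => [|i _]; first exact: form_values_ideal.
rewrite -mul_polyC mulrC; apply: ideal_mull; first exact: form_values_ideal.
have [p hp ->] := Vy i; exists (map_mpoly polyC p); first exact: homog_map.
by rewrite meval_map_mpoly.
Qed.

Lemma form_values_monic (g : {poly B}) : g \is monic ->
  forall j y, form_values Cf j (g * y) -> form_values Cf j y.
Proof.
move=> mg j y /form_values_polyC Vgy; apply/form_values_polyC.
exact: (coef_ideal_monic (form_values_ideal f j) mg).
Qed.

Lemma mpoly_coefE (p : {mpoly {poly B}[s]}) : exists l,
  p = \sum_(i < l) 'X^i *: map_mpoly polyC (map_mpoly (coefp i) p).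
Proof.
exists (\max_(m <- msupp p) size p@_m)%N; apply/mpolyP => m.
rewrite (raddf_sum (mcoeff m)).
set l := (\max_(_ <- _) _)%N.
transitivity (\poly_(i < l) (p@_m)`_i); last first.
  rewrite poly_def; apply: eq_bigr => i _.
  by rewrite [RHS]mcoeffZ !mcoeff_map_mpoly mulrC /= mul_polyC.
apply/polyP => i; rewrite coef_poly; case: ltnP => // le.
apply: nth_default; apply: leq_trans le.
have [mp|mp] := boolP (m \in msupp p); last by rewrite (memN_msupp_eq0 mp) size_poly0.
exact: (@leq_bigmax_seq _ (msupp p) xpredT (fun m => size p@_m)).
Qed.

(** [B[X]] is free over [B], so an equation splits into equations over [B], one for each power of
    [X]. *)
Lemma generated_polyC N : generated_in_degree_le (rees_equations f) N ->
  generated_in_degree_le (rees_equations Cf) N.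
Proof.
move=> /generated_in_degree_leP gen; apply/generated_in_degree_leP => d p hp p0.
have [l ->] := mpoly_coefE p; apply: ideal_sum => [|i _]; first exact: ideal_gen_ideal.
rewrite -mul_mpolyC; apply: ideal_mull; first exact: ideal_gen_ideal.
apply: homog_rees_map; apply: (gen d); first exact: homog_map.
by rewrite -coef_meval p0 coef0.
Qed.

End PolynomialExtension.

Definition algebraic_mod (k : fieldType) n (P : set {mpoly k[n]}) :=
  forall a, exists2 F : {poly k}, F != 0 & P (map_poly (@mpolyC n k) F).[a].

(** Powers of [a] cancel modulo the prime [P] until the relation has a nonzero constant term, which
    yields an inverse of [a]. *)
Lemma algebraic_mod_inverse (k : fieldType) n (P : set {mpoly k[n]}) a :
  prime_ideal P -> algebraic_mod P -> ~ P a -> exists b, P (a * b - 1).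
Proof.
move=> prP algP Pa; have [F F0] := algP a; have [idP _ prM] := prP.
have [l lF] := ubnP (size F); elim: l => // l IHl in F F0 lF *.
have [q [c defF]] : exists q c, F = q * 'X + c%:P.
  by elim/poly_ind: {+}F => [|q c _]; [exists 0, 0; rewrite mul0r addr0 | exists q, c].
rewrite defF rmorphD rmorphM /= map_polyX map_polyC !hornerE /=.
have [c0|c0] := eqVneq c 0.
  rewrite c0 mpolyC0 addr0 => /prM[] //; apply: IHl.
    by apply: contraNneq F0 => q0; rewrite defF q0 c0 mul0r addr0.
  by move: lF; rewrite defF c0 addr0 size_mulX //;
    apply: contraNneq F0 => q0; rewrite defF q0 c0 mul0r addr0.
set Q := (map_poly _ q).[a] => PF; exists (- (c^-1 *: Q)).
have -> : a * - (c^-1 *: Q) - 1 = - c^-1%:MP * (Q * a + c%:MP).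
  rewrite mulrDr !mulNr -mpolyCM mulVf // mpolyC1; congr (_ - _).
  by rewrite mulrN mul_mpolyC -scalerAr [a * Q]mulrC.
exact: ideal_mull.
Qed.

(* [P] is generated by [P \cap k[x_1..x_n]], where algebraicity makes nonzero  *)
(* leading coefficients invertible, and one polynomial monic in [x_(n+1)].     *)
Theorem algebraic_prime_rt_le1 (k : fieldType) n (P : set {mpoly k[n]}) :
  prime_ideal P -> algebraic_mod P -> rt_le P 1.
Proof.
elim: n => [|n IHn] in P * => prP algP; have [idP PT prM] := prP.
  (* In zero variables the ring is [k], so [P] is zero and the empty family generates it. *)
  exists 0%N, (fun=> 0); split; last first.
    apply/generated_in_degree_leP => d p hp p0.
    suff -> : p = 0 by apply: ideal0; apply: ideal_gen_ideal.
    rewrite (nvar0_mpolyC p) in p0 *.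
    by rewrite mevalC in p0; rewrite p0 mpolyC0.
  apply/seteqP; split=> x; last first.
    by move=> /ideal_gen_rangeP[c ->]; rewrite big_ord0; apply: ideal0.
  move=> Px; apply/ideal_gen_rangeP; exists (fun=> 0); rewrite big_ord0.
  apply/eqP; apply: contrapT => /negP x0; apply: (prime_ideal1 prP).
  move: Px x0; rewrite (nvar0_mpolyC x) mpolyC_eq0 => Px x0.
  rewrite -(mpolyC1 0 k) -(mulVf x0) mpolyCM; exact: ideal_mull.
pose p : set {mpoly k[n]} := (@mwiden n k) @^-1` P.
have prp : prime_ideal p by apply: (prime_ideal_preimage (@mwiden n k)).
have algp : algebraic_mod p.
  move=> a; have [F F0 PF] := algP (mwiden a); exists F => //.
  rewrite /p /= -horner_map /= -map_poly_comp.
  by rewrite (@eq_map_poly _ _ _ (@mpolyC n.+1 k)) // => x /=; rewrite mwidenC.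
have [s [f [pf gen]]] := IHn p prp algp.
pose P' : set {poly {mpoly k[n]}} := (@of_uni k n) @^-1` P.
have idP' : is_ideal P' by apply: (ideal_preimage (@of_uni k n)).
have P'C c : P' c%:P <-> p c by rewrite /P' /= of_uniC.
(* The algebraic relation of the last variable over [k], divided by its leading coefficient, is a
   monic element of [P']. *)
have ex_monic : exists l, `[< exists g, [/\ g \is monic, P' g & size g = l] >].
  have [F F0 PF] := algP 'X_ord_max.
  pose G := map_poly (@mpolyC n k) ((lead_coef F)^-1 *: F).
  exists (size G); apply/asboolP; exists G; split=> //.
    by rewrite map_monic monicE lead_coefZ mulVf // lead_coef_eq0.
  rewrite /P' /= /of_uni /G -map_poly_comp.
  rewrite (@eq_map_poly _ _ _ (@mpolyC n.+1 k)); last by move=> x /=; rewrite mwidenC.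
  by rewrite linearZ /= hornerZ; apply: ideal_mull.
have [l /asboolP[g [mg P'g sg]] gmin] := ex_minnP ex_monic.
(* With [g] monic of least size in [P'], a smaller element has its leading coefficient in [p]:
   otherwise inverting it modulo [p] would give a smaller monic element. *)
have small h : P' h -> (size h < size g)%N -> forall i, p h`_i.
  have [m hm] := ubnP (size h); elim: m => // m IHm in h hm *.
  move=> P'h hg; have [->|h0] := eqVneq h 0.
    by move=> i; rewrite coef0; apply/P'C; rewrite polyC0; apply: ideal0.
  have pl : p (lead_coef h).
    apply: contrapT => /(algebraic_mod_inverse prp algp)[b pb].
    (* The correction term makes the leading coefficient exactly 1, and lies in [P'] because its
       coefficient is in [p]. *)
    pose h' := b *: h - (lead_coef h * b - 1) *: 'X^((size h).-1).
    have P'h' : P' h'.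
      apply: idealB => //; rewrite -mul_polyC; first exact: ideal_mull.
      by apply: ideal_mulr => //; apply/P'C.
    have h'l : h'`_(size h).-1 = 1.
      by rewrite coefB !coefZ coefXn eqxx mulr1 mulrC subKr.
    have sh' : size h' = size h.
      apply/eqP; rewrite eqn_leq; apply/andP; split.
        apply/leq_sizeP => j hj; rewrite coefB !coefZ coefXn nth_default // mulr0.
        by rewrite gtn_eqF ?mulr0 ?subrr // -(polySpred h0).
      rewrite (polySpred h0); apply: contraT; rewrite -leqNgt => /leq_sizeP/(_ _ (leqnn _)).
      by rewrite h'l => /eqP; rewrite oner_eq0.
    have : (l <= size h')%N.
      apply: gmin; apply/asboolP; exists h'; split=> //.
      by rewrite monicE /lead_coef sh' h'l.
    by rewrite sh' leqNgt -sg hg.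
  pose z := h - lead_coef h *: 'X^((size h).-1).
  have zi i : z`_i = h`_i - lead_coef h * (i == (size h).-1)%:R.
    by rewrite coefB coefZ coefXn.
  have zh : (size z < size h)%N by apply: size_drop_lead.
  have P'z : P' z.
    apply: idealB => //; rewrite -mul_polyC; apply: ideal_mulr => //; exact/P'C.
  have pz := IHm z (leq_trans zh hm) P'z (ltn_trans zh hg).
  have [idp _ _] := prp.
  move=> i; rewrite -[h`_i](subrK (lead_coef h * (i == (size h).-1)%:R)) -zi.
  by apply: idealD => //; apply: ideal_mulr.
have P'gen : P' = ideal_gen (range (adjoin_family (polyC \o f) g)).
  have idG := ideal_gen_ideal (range (adjoin_family (polyC \o f) g)).
  apply/seteqP; split=> h; last first.
    apply: ideal_gen_min => // _ [i _ <-]; rewrite /adjoin_family.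
    by case: unlift => [j|] //=; apply/P'C; rewrite pf; apply: mem_range_ideal_gen.
  (* Division by [g] leaves a remainder in [P'] of smaller size, whose coefficients are in [p] by
     [small]. *)
  move=> P'h; rewrite [h](Pdiv.RingMonic.rdivp_eq mg).
  apply: idealD => //.
    apply: ideal_mull => //; rewrite -{2}(adjoin_family_max (polyC \o f) g).
    exact: mem_range_ideal_gen.
  set r := Pdiv.Ring.rmodp h g.
  have P'r : P' r.
    have -> : r = h - Pdiv.Ring.rdivp h g * g.
      by apply/esym/eqP; rewrite subr_eq addrC /r -(Pdiv.RingMonic.rdivp_eq mg h).
    by apply: idealB => //; apply: ideal_mull.
  have rg : (size r < size g)%N by rewrite Pdiv.Ring.ltn_rmodp monic_neq0.
  rewrite -[r]coefK poly_def; apply: ideal_sum => // i _.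
  rewrite -mul_polyC; apply: ideal_mulr => //.
  have := small r P'r rg i; rewrite pf => /ideal_gen_rangeP[c ->].
  rewrite rmorph_sum; apply: ideal_sum => // j _; rewrite rmorphM /=.
  apply: ideal_mull => //; rewrite -[(f j)%:P]/((polyC \o f) j).
  by rewrite -(adjoin_family_widen (polyC \o f) g); apply: mem_range_ideal_gen.
have rtP' : rt_le P' 1.
  exists s.+1, (adjoin_family (polyC \o f) g); split=> //.
  apply: generated_adjoin; last exact: generated_polyC.
  exact: form_values_monic.
have -> : P = (@muni n k) @^-1` P'.
  by apply/seteqP; split=> x; rewrite /P' /= muniK.
exact: rt_le_iso (@of_uniK k n) (@muniK k n) rtP'.
Qed.

(** * Chains of primes *)

Section AlgebraicDependence.
Variables (k : fieldType) (n : nat).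

Lemma msize_mmap1 m (v : 'I_m -> {mpoly k[n]}) c (M : 'X_{1..m}) :
  (forall i, msize (v i) <= c.+1)%N -> (msize (mmap1 v M) <= (c * mdeg M).+1)%N.
Proof.
move=> vc; rewrite /mmap1 mdegE big_distrr /=.
have szM (p q : {mpoly k[n]}) a b : (msize p <= a.+1 -> msize q <= b.+1 ->
    msize (p * q) <= (a + b).+1)%N.
  move=> pa qb; have [->|p0] := eqVneq p 0; first by rewrite mul0r mmeasure0.
  have [->|q0] := eqVneq q 0; first by rewrite mulr0 mmeasure0.
  by rewrite msizeM_proper ?mulf_neq0 ?mleadc_eq0 //; lia.
elim/big_ind2: _ => [|p a q b|i _]; first by rewrite msize1.
  exact: szM.
elim: (M i) => [|e IHe]; first by rewrite expr0 msize1.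
by rewrite exprS mulnS; apply: szM.
Qed.

(* Counting: the [D ^ (n + 1)] monomials with exponents below [D] in the [v i] *)
(* lie in a space of dimension [(K * D) ^ n], which is smaller for large [D].  *)
Lemma algebraic_dependence (v : 'I_n.+1 -> {mpoly k[n]}) :
  exists2 F : {mpoly k[n.+1]}, F != 0 & mmap (@mpolyC n k) v F = 0.
Proof.
pose c := (\max_i msize (v i))%N.
have vc i : (msize (v i) <= c.+1)%N by apply: leqW; apply: leq_bigmax.
(* Products of the [v i] with exponents below [D] have degree at most [c (n + 1) D < K D], and
   [D > K ^ n] gives [D ^ (n + 1) > (K D) ^ n]. *)
pose K := (c * n.+1).+1; pose D := (K ^ n).+1.
pose src := {ffun 'I_n.+1 -> 'I_D}; pose tgt := {ffun 'I_n -> 'I_(K * D)}.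
have card_lt : (#|tgt| < #|src|)%N.
  rewrite !card_ffun !card_ord expnMn expnS.
  by rewrite ltn_pmul2r ?expn_gt0.
pose mon m e (phi : {ffun 'I_m -> 'I_e}) : 'X_{1..m} := [multinom phi i : nat | i < m].
pose A : 'M[k]_(#|src|, #|tgt|) :=
  \matrix_(i, j) (mmap1 v (mon _ _ (enum_val i)))@_(mon _ _ (enum_val j)).
have : kermx A != 0.
  rewrite -mxrank_eq0 mxrank_ker subn_eq0 -ltnNge.
  exact: leq_ltn_trans (rank_leq_col A) card_lt.
case/rowV0Pn => u /sub_kermxP uA u0.
exists (\sum_i u 0 i *: 'X_[mon _ _ (enum_val i)]).
  have [i0 ui0] : exists i, u 0 i != 0.
    by apply/existsP; apply: contraNT u0 => /existsPn u0;
      apply/eqP/rowP => i; rewrite mxE; apply/eqP; have := u0 i; rewrite negbK.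
  apply: contraNneq ui0 => /(congr1 (mcoeff (mon _ _ (enum_val i0)))).
  rewrite mcoeff0 raddf_sum (bigD1 i0) //= mcoeffZ mcoeffX eqxx mulr1.
  rewrite big1 ?addr0 => [-> //|i ne]; rewrite mcoeffZ mcoeffX.
  case: eqP => [e|]; last by rewrite mulr0.
  case/negP: ne; apply/eqP/enum_val_inj/ffunP => j; apply: val_inj => /=.
  by have /mnmP/(_ j) := e; rewrite !mnmE.
rewrite raddf_sum; apply/mpolyP => N; rewrite mcoeff0 raddf_sum /=.
under eq_bigr do rewrite mmapZ mmapX mul_mpolyC mcoeffZ.
have [small|] := boolP [forall j, N j < K * D]%N; last first.
  move=> /forallPn[j]; rewrite -leqNgt => Nj; apply: big1 => i _.
  rewrite (_ : _@_N = 0) ?mulr0 //; apply/eqP; rewrite mcoeff_eq0.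
  apply: mmeasure_mnm_ge; apply: leq_trans (msize_mmap1 _ vc) _.
  apply: leq_trans (_ : N j <= mdeg N)%N; last by rewrite mdegE (bigD1 j) ?leq_addr.
  apply: leq_trans Nj.
  have : (mdeg (mon _ _ (enum_val i)) <= n.+1 * D)%N.
    have -> : (n.+1 * D = \sum_(l < n.+1) D)%N by rewrite sum_nat_const card_ord.
    rewrite mdegE; apply: leq_sum => l _.
    by rewrite mnmE ltnW.
  rewrite /K; move: (mdeg _) => d le_d.
  have : (c * d <= c * n.+1 * D)%N by rewrite -mulnA leq_mul2l le_d orbT.
  by rewrite mulSn; rewrite {2}/D; lia.
pose phi : tgt := [ffun j => Ordinal (forallP small j)].
have Nphi : N = mon _ _ phi by apply/mnmP => j; rewrite mnmE ffunE.
have := congr1 (fun B : 'rV_ _ => B 0 (enum_rank phi)) uA.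
rewrite !mxE => uA0; rewrite -[RHS]uA0; apply: eq_bigr => i _.
by rewrite /A mxE enum_rankK -Nphi.
Qed.

End AlgebraicDependence.

Section Chains.
Variables (k : fieldType) (n : nat).
Local Notation R := {mpoly k[n]}.

(* Coquand-Lombardi: elements [v i] picked in the gaps of a chain of primes    *)
(* satisfy no polynomial relation modulo the bottom prime, seen by factoring   *)
(* out powers of the last variable.                                            *)
Lemma chain_independent m (c : nat -> set R) b :
  (forall i, (i <= m)%N -> prime_ideal (c i)) ->
  (forall i, (i < m)%N -> c i `<` c i.+1) ->
  (forall F : {poly k}, F != 0 -> ~ c m (map_poly (@mpolyC n k) F).[b]) ->
  exists v : nat -> R, forall F : {mpoly k[m.+1]}, F != 0 ->
    ~ c 0%N (mmap (@mpolyC n k) (fun i => v i) F).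
Proof.
elim: m c => [|m IHm] c prc ltc transc.
  exists (fun=> b) => F F0.
  pose q := muni F; pose G := map_poly (mcoeff 0%MM) q.
  have -> : mmap (@mpolyC n k) (fun=> b) F = (map_poly (@mpolyC n k) G).[b].
    rewrite -[F]muniK -/q /of_uni -horner_map /= mmapX mmap1U -!map_poly_comp.
    congr (_.[b]); apply: eq_map_poly => x /=.
    by rewrite {1}(nvar0_mpolyC x) mwidenC mmapC.
  apply: transc; apply: contraNneq F0 => G0; rewrite -[F]muniK -/q.
  suff -> : q = 0 by rewrite rmorph0.
  apply/polyP => i; rewrite coef0 (nvar0_mpolyC q`_i).
  by have := congr1 (fun p : {poly k} => p`_i) G0; rewrite coef_map coef0 /= => ->.
have [||//|v' hv'] := IHm (fun i => c i.+1).
- by move=> i im; apply: prc.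
- by move=> i im; apply: ltc.
have [c01 /nonsubset[a [c1a c0a]]] := ltc 0%N isT.
(* The last variable receives an element of [c 1] outside [c 0]. *)
pose v i := if (i < m.+1)%N then v' i else a.
exists v => F F0; rewrite -[F]muniK.
have : muni F != 0 by apply: contraNneq F0 => h; rewrite -[F]muniK h rmorph0.
pose ev := mmap (@mpolyC n k) (fun i : 'I_m.+2 => v i).
have evX : ev 'X_ord_max = a by rewrite /ev mmapX mmap1U /v ltnn.
have evC p : ev (mwiden p) = mmap (@mpolyC n k) (fun i => v' i) p.
  rewrite /ev mwidenE_mmap rmorph_mmap; apply: eq_mmap => [x|i] /=.
    by rewrite mmapC.
  by rewrite mmapX mmap1U /v /= ltn_ord.
have [id0 _ prM0] := prc 0%N isT; have [id1 _ _] := prc 1%N isT.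
rewrite -/ev; elim/poly_ind: (muni F) => [|q p IHq]; first by rewrite eqxx.
have -> : ev (of_uni (q * 'X + p%:P)) = ev (of_uni q) * a + ev (mwiden p).
  by rewrite rmorphD rmorphM /= of_uniX of_uniC /ev rmorphD rmorphM /= -/ev evX.
(* If the constant term [p] is zero, [a] cancels modulo [c 0]; otherwise [a] in [c 1] puts the value
   of [p] in [c 1], against the induction hypothesis. *)
rewrite evC; have [->|p0 _ c0] := eqVneq p 0.
  rewrite mmap0 !addr0 => qX0 /prM0[] //; apply: IHq.
  by apply: contraNneq qX0 => ->; rewrite mul0r.
apply: (hv' p p0); rewrite -[X in c _ X](addKr (ev (of_uni q) * a)) addrC.
by apply: idealB => //; [exact: c01 | exact: ideal_mull].
Qed.

(** A transcendental element modulo the top prime would give [n + 1] algebraically independent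
    elements of a polynomial ring in [n] variables. *)
Lemma chain_algebraic (c : nat -> set R) :
  (forall i, (i <= n)%N -> prime_ideal (c i)) ->
  (forall i, (i < n)%N -> c i `<` c i.+1) -> algebraic_mod (c n).
Proof.
move=> prc ltc b; apply: contrapT => noF.
have [|v hv] := chain_independent (b := b) prc ltc.
  by move=> F F0 cF; apply: noF; exists F.
have [F F0 vF] := algebraic_dependence (fun i : 'I_n.+1 => v i).
by apply: (hv F F0); rewrite vF; apply: ideal0; have [] := prc 0%N isT.
Qed.

Lemma algebraic_mod_maximal (P Q : set R) :
  prime_ideal P -> algebraic_mod P -> is_ideal Q -> P `<` Q -> Q 1.
Proof.
move=> prP algP idQ [PQ /nonsubset[a [Qa Pa]]].
have [b Pab] := algebraic_mod_inverse prP algP Pa.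
rewrite -[1](subKr (a * b)); apply: idealB => //; first exact: ideal_mulr.
exact: PQ.
Qed.

(** The prime at position [n] is already maximal, so the chain cannot continue. *)
Lemma prime_chain_le (P : set R) m : prime_chain_to P m -> (m <= n)%N.
Proof.
move=> [c [prc ltc _]]; rewrite leqNgt; apply/negP => nm.
have algn : algebraic_mod (c n).
  apply: chain_algebraic => i im; first by apply: prc; apply: leq_trans (ltnW nm).
  by apply: ltc; apply: leq_trans (ltnW nm).
apply: (prime_ideal1 (prc n.+1 nm)).
apply: (algebraic_mod_maximal (prc n (ltnW nm)) algn _ (ltc n nm)).
by have [] := prc n.+1 nm.
Qed.

Lemma prime_height_exists (P : set R) : prime_ideal P -> exists h, prime_height P h.
Proof.
move=> prP; have ex : exists m, `[< prime_chain_to P m >].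
  by exists 0%N; apply/asboolP; exists (fun=> P).
have ub m : `[< prime_chain_to P m >] -> (m <= n)%N by move=> /asboolP/prime_chain_le.
have [h /asboolP hP hmax] := ex_maxnP ex ub; exists h; split=> // m hm.
by apply: hmax; apply/asboolP.
Qed.

End Chains.

Lemma prime_height_ideal_height (R : comNzRingType) (P : set R) h :
  prime_ideal P -> prime_height P h -> ideal_height P h.
Proof.
move=> prP hP; split; first by exists P; split.
move=> Q prQ PQ; have [[c [prc ltc cP]] _] := hP.
have [<-|ne] := pselect (P = Q); first by exists c.
(* The bottom prime is dropped and [Q] is appended, which keeps the length [h]. *)
exists (fun i => if (i < h)%N then c i.+1 else Q); split.
- by move=> i ih; case: ifP => // lt; apply: prc.
- move=> i ih; rewrite ih; case: ifP => lt; first exact: ltc.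
  have -> : i.+1 = h by apply/eqP; rewrite eqn_leq ih leqNgt lt.
  by rewrite cP; split=> // QP; apply: ne; apply/seteqP.
- by rewrite ltnn.
Qed.

Lemma zero_prime_ideal (R : idomainType) : prime_ideal [set (0 : R)].
Proof.
split.
- split=> [|x y -> ->|a x ->] //; first by rewrite addr0.
  by rewrite mulr0.
- move=> e; have : [set (0 : R)] 1 by rewrite e.
  by move/eqP; rewrite oner_eq0.
- by move=> x y /eqP; rewrite mulf_eq0 => /orP[/eqP|/eqP]; [left|right].
Qed.

Lemma prime_height_gt0 (R : idomainType) (P : set R) h :
  prime_ideal P -> P <> [set 0] -> prime_height P h -> (0 < h)%N.
Proof.
move=> prP P0 [_ hmax]; apply: hmax.
exists (fun i => if i is 0%N then [set 0] else P); split=> //.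
- by move=> [|i] _ //; apply: zero_prime_ideal.
- move=> [|i] // _; have [idP _ _] := prP.
  split=> [_ ->|P0']; first exact: ideal0.
  by apply: P0; apply/seteqP; split=> // _ ->; apply: ideal0.
Qed.

(** * The Hilbert basis theorem *)

Definition noetherian (R : comNzRingType) := forall I : set R, is_ideal I -> fin_gen I.

Lemma noetherian_surj (R S : comNzRingType) (phi : {rmorphism R -> S}) (psi : S -> R) :
  cancel psi phi -> noetherian R -> noetherian S.
Proof.
move=> psiK noethR I idI.
have [s [f If]] := noethR _ (ideal_preimage phi idI).
exists s, (phi \o f); apply/seteqP; split=> x.
  move=> Ix; have : (phi @^-1` I) (psi x) by rewrite /= psiK.
  rewrite If => /ideal_gen_rangeP[c hc]; apply/ideal_gen_rangeP.
  exists (phi \o c); rewrite -[LHS]psiK hc rmorph_sum.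
  by apply: eq_bigr => i _; rewrite rmorphM.
apply: ideal_gen_min => // _ [i _ <-].
by rewrite -[I _]/((phi @^-1` I) (f i)) If; apply: mem_range_ideal_gen.
Qed.

Lemma fin_gen_seq (R : comNzRingType) (l : seq R) : fin_gen (ideal_gen [set x | x \in l]).
Proof.
exists (size l), (fun i => l`_i); apply/seteqP; split.
  apply: ideal_gen_min => [|x /= xl]; first exact: ideal_gen_ideal.
  have il : (index x l < size l)%N by rewrite index_mem.
  rewrite -(nth_index 0 xl).
  exact: (mem_range_ideal_gen (fun i : 'I_(size l) => l`_i) (Ordinal il)).
apply: ideal_gen_min => [|_ [i _ <-]]; first exact: ideal_gen_ideal.
by apply: sub_ideal_gen; apply: mem_nth.
Qed.

Section Hilbert.
Variable A : comNzRingType.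
Hypothesis noethA : noetherian A.

(** The ideals of initial segments increase to a finitely generated ideal, whose generators all lie
    in one of them. *)
Lemma noetherian_stationary (a : nat -> A) :
  exists M, ideal_gen [set x | exists2 i, (i < M)%N & x = a i] (a M).
Proof.
pose J M := ideal_gen [set x | exists2 i, (i < M)%N & x = a i].
have idJ M : is_ideal (J M) by apply: ideal_gen_ideal.
have Jle M M' : (M <= M')%N -> J M `<=` J M'.
  move=> le; apply: ideal_gen_min => // _ [i iM ->].
  by apply: sub_ideal_gen; exists i => //; apply: leq_trans le.
pose U := \bigcup_M J M.
have idU : is_ideal U.
  split; first by exists 0%N => //; apply: ideal0.
    move=> x y [M _ Jx] [M' _ Jy]; exists (maxn M M') => //.
    apply: idealD => //; [apply: Jle Jx; apply: leq_maxl | apply: Jle Jy; apply: leq_maxr].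
  by move=> b x [M _ Jx]; exists M => //; apply: ideal_mull.
have [s [g Ug]] := noethA idU.
have /choice[N JN] : forall i, exists M, J M (g i).
  move=> i; have : U (g i) by rewrite Ug; apply: mem_range_ideal_gen.
  by move=> [M _ JM]; exists M.
exists (\max_i N i)%N; set M := (\max_i N i)%N.
have : U (a M) by exists M.+1 => //; apply: sub_ideal_gen; exists M.
rewrite Ug; apply: ideal_gen_min => [|_ [i _ <-]]; first exact: ideal_gen_ideal.
by apply: Jle (JN i); apply: leq_bigmax.
Qed.

(* Successive elements [F i] of least degree outside the ideal of the previous *)
(* ones: a relation between leading coefficients lowers the degree.            *)
Theorem hilbert_basis : noetherian {poly A}.
Proof.
move=> I idI; apply: contrapT => nfg.
pose span (l : seq {poly A}) := ideal_gen [set x | x \in l].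
have /choice[next hnext] : forall l : seq {poly A}, exists h,
    (forall x, x \in l -> I x) -> [/\ I h, ~ span l h &
      forall h', I h' -> ~ span l h' -> (size h <= size h')%N].
  move=> l; have [lI|nlI] := pselect (forall x, x \in l -> I x); last by exists 0.
  have [h0 [Ih0 h0l]] : I `&` ~` span l !=set0.
    apply: nonsubset => Il; apply: nfg.
    suff -> : I = span l by apply: fin_gen_seq.
    by apply/seteqP; split=> //; apply: ideal_gen_min.
  have ex : exists m, `[< exists h, [/\ I h, ~ span l h & size h = m] >].
    by exists (size h0); apply/asboolP; exists h0.
  have [m /asboolP[h [Ih hl <-]] hmin] := ex_minnP ex.
  exists h; split=> // h' Ih' h'l; apply: hmin.
  by apply/asboolP; exists h'.
pose L m := iter m (fun l => rcons l (next l)) [::].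
pose F m := next (L m).
have LS m : L m.+1 = rcons (L m) (F m) by [].
have LP m x : x \in L m <-> exists2 i, (i < m)%N & x = F i.
  elim: m => [|m IHm] in x *; first by split=> // -[].
  rewrite LS mem_rcons inE; split.
    case/predU1P => [->|/IHm[i im ->]]; first by exists m.
    by exists i => //; apply: leqW.
  move=> [i]; rewrite ltnS leq_eqVlt => /predU1P[-> ->|im ->]; first by rewrite eqxx.
  by apply/orP; right; apply/IHm; exists i.
have LI m : forall x, x \in L m -> I x.
  elim: m => [|m IHm] x //; rewrite LS mem_rcons inE => /predU1P[->|]; last exact: IHm.
  by have [] := hnext _ IHm.
have FP m := hnext _ (LI m).
have FI m : I (F m) by have [] := FP m.
have F0 m : F m != 0.
  have [_ + _] := FP m; apply: contra_notN; rewrite -/(F m) => /eqP ->.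
  by apply: ideal0; apply: ideal_gen_ideal.
have Fle i m : (i <= m)%N -> (size (F i) <= size (F m))%N.
  move=> im; have [_ _ hmin] := FP i; have [Im nm _] := FP m.
  apply: hmin => // si; apply: nm; apply: ideal_gen_min si; first exact: ideal_gen_ideal.
  move=> x /LP[j ji ->]; apply: sub_ideal_gen; apply/LP; exists j => //.
  exact: leq_trans im.
have [M [m [c [g [ga aM]]]]] := noetherian_stationary (fun i => lead_coef (F i)).
have {ga} /choice[t ht] : forall j, exists i, (i < M)%N /\ g j = lead_coef (F i).
  by move=> j; have [i iM ->] := ga j; exists i.
have [IM nM minM] := FP M; rewrite -/(F M) in IM nM minM.
(* The shifts align the leading terms, so [z] cancels the leading term of [F M]. *)
pose e j := (size (F M) - size (F (t j)))%N.
pose z := \sum_(j < m) (c j *: 'X^(e j)) * F (t j).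
have spz : span (L M) z.
  apply: ideal_sum => [|j _]; first exact: ideal_gen_ideal.
  apply: ideal_mull; first exact: ideal_gen_ideal.
  by apply: sub_ideal_gen; apply/LP; exists (t j) => //; have [] := ht j.
have Iz : I z by apply: ideal_gen_min spz => //; apply: LI.
have : (size (F M) <= size (F M - z)%R)%N.
  apply: minM; first exact: idealB.
  by move=> spMz; apply: nM; apply: (idealBK _ spMz) => //; apply: ideal_gen_ideal.
apply/negP; rewrite -ltnNge (polySpred (F0 M)) ltnS; apply/leq_sizeP => d dM.
have coefz j : ((c j *: 'X^(e j)) * F (t j))`_d = c j * (F (t j))`_(d - e j).
  rewrite -scalerAl coefZ coefXnM ltnNge (leq_trans _ dM) //.
  rewrite /e -subn1 leq_sub2l // size_poly_gt0; exact: F0.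
rewrite coefB coef_sum; under eq_bigr do rewrite coefz.
have tM j : (size (F (t j)) <= size (F M))%N by apply: Fle; apply: ltnW; have [] := ht j.
have [->|ne] := eqVneq d (size (F M)).-1.
  apply/eqP; rewrite subr_eq0 -[X in X == _]/(lead_coef (F M)) aM; apply/eqP.
  apply: eq_bigr => j _; have [_ ->] := ht j; congr (_ * _); rewrite lead_coefE.
  congr (_`_ _); have := tM j; rewrite /e.
  by move: (F0 (t j)); rewrite -size_poly_gt0; lia.
have dM' : (size (F M) <= d)%N by rewrite (polySpred (F0 M)) ltn_neqAle eq_sym ne.
rewrite nth_default // sub0r big1 ?oppr0 // => j _.
rewrite (nth_default _ (_ : size (F (t j)) <= d - e j)%N) ?mulr0 //.
by have := tM j; rewrite /e; lia.
Qed.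

End Hilbert.

Lemma noetherian_field (k : fieldType) : noetherian k.
Proof.
move=> I idI; have [I0|] := pselect (I `<=` [set 0]).
  exists 0%N, (fun=> 0); apply/seteqP; split=> x.
    by move=> /I0 ->; apply: ideal0; apply: ideal_gen_ideal.
  by move=> /ideal_gen_rangeP[c ->]; rewrite big_ord0; apply: ideal0.
move=> /nonsubset[x [Ix /eqP x0]]; exists 1%N, (fun=> 1).
rewrite unit_family_gen; apply: ideal_setT => //.
by rewrite -(mulVf x0); apply: ideal_mull.
Qed.

Lemma noetherian_mpoly (A : comNzRingType) n :
  noetherian A -> noetherian {mpoly A[n]}.
Proof.
move=> noethA; elim: n => [|n IHn].
  apply: (noetherian_surj (phi := @mpolyC 0 A) (psi := mcoeff 0%MM)) noethA.
  exact: mpolyKC.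
apply: (noetherian_surj (phi := @of_uni A n) (psi := @muni n A)); first exact: muniK.
exact: hilbert_basis.
Qed.

(** The equations form a finitely generated ideal, and the homogeneous components of its generators
    are again equations. *)
Lemma noetherian_rt_le (R : comNzRingType) (I : set R) :
  noetherian R -> is_ideal I -> exists N, rt_le I N.
Proof.
move=> noethR idI; have [s [f If]] := noethR I idI.
have [m [F LF]] := noetherian_mpoly noethR (rees_equations_ideal f).
pose N := (\max_(i < m) msize (F i))%N; exists N; exists s, f; split=> //.
apply/seteqP; split; last exact: homog_rees_sub.
rewrite [X in X `<=` _]LF; apply: ideal_gen_min => [|_ [i _ <-]]; first exact: ideal_gen_ideal.
rewrite [F i]homog_pihomog_sum; apply: ideal_sum => [|d _]; first exact: ideal_gen_ideal.
apply: sub_ideal_gen; split.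
  apply/(rees_equations_homog f (pihomogP mdeg d (F i))).
  have /rees_equationsP : rees_equations f (F i) by rewrite LF; apply: mem_range_ideal_gen.
  exact.
exists d; last exact: pihomogP.
by apply: leq_trans (ltnW (ltn_ord d)) _; apply: leq_bigmax.
Qed.

(** * Factoriality of polynomial rings *)

Section Factorization.
Variable A : idomainType.
Implicit Types (a b x y : A).

Definition principal a : set A := [set x | exists c, x = c * a].

Lemma principal_ideal a : is_ideal (principal a).
Proof.
split; first by exists 0; rewrite mul0r.
  by move=> _ _ [c ->] [d ->]; exists (c + d); rewrite mulrDl.
by move=> b _ [c ->]; exists (b * c); rewrite mulrA.
Qed.

Lemma principal_id a : principal a a.
Proof. by exists 1; rewrite mul1r. Qed.

Definition prime_elt a := a != 0 /\ prime_ideal (principal a).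

(** A unit times [n] primes; [principal a 1] says that [a] is a unit. *)
Fixpoint prime_factors n a : Prop :=
  if n is m.+1 then exists p b, [/\ prime_elt p, a = p * b & prime_factors m b]
  else principal a 1.

Definition factorial := forall a, a != 0 -> exists n, prime_factors n a.

Lemma prime_elt_neq1 p : prime_elt p -> ~ principal p 1.
Proof. by move=> [_]; apply: prime_ideal1. Qed.

Lemma principal_unit_mul u a : principal (u * a) 1 -> principal u 1.
Proof. by move=> [c e]; exists (c * a); rewrite e mulrCA mulrC -mulrA. Qed.

Lemma principal_unitM u v : principal u 1 -> principal v 1 -> principal (u * v) 1.
Proof. by move=> [c e] [d e']; exists (c * d); rewrite mulrACA -e -e' mulr1. Qed.

Lemma prime_factors_unitM n u a : principal u 1 -> prime_factors n a ->
  prime_factors n (u * a).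
Proof.
move=> uU; elim: n a => [|n IHn] a /=; first exact: principal_unitM.
by move=> [p [b [pp -> /IHn hb]]]; exists p, (u * b); rewrite mulrCA.
Qed.

(** The count drops by exactly one, which is what the minimality argument in [gauss] needs. *)
Lemma prime_factors_divP n p a : prime_elt p -> prime_factors n (p * a) ->
  exists2 m, n = m.+1 & prime_factors m a.
Proof.
move=> pp; have [p0 [_ _ prM]] := pp.
elim: n a => [|n IHn] a /=; first by move=> /principal_unit_mul/(prime_elt_neq1 pp).
move=> [q [b [qp e hb]]]; have [q0 [_ _ qrM]] := qp.
have : principal p (q * b) by exists a; rewrite -e mulrC.
case/prM => [[v qE]|[c bE]]; last first.
  have [m nm hc] : exists2 m, n = m.+1 & prime_factors m c.
    by apply: IHn; rewrite mulrC -bE.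
  exists n => //; rewrite nm; exists q, c; split=> //.
  by apply: (mulfI p0); rewrite e bE; ring.
have : principal q (v * p) by rewrite -qE; apply: principal_id.
have vab : a = v * b by apply: (mulfI p0); rewrite e qE; ring.
case/qrM => -[w].
  move=> vE; case: (prime_elt_neq1 pp); exists w.
  by apply: (mulfI q0); rewrite mulr1 {1}qE vE; ring.
move=> pE; exists n => //; rewrite vab; apply: prime_factors_unitM hb.
by exists w; apply: (mulfI p0); rewrite mulr1 {1}pE qE; ring.
Qed.

Lemma prime_factorsM n m x y : prime_factors n x -> prime_factors m y ->
  prime_factors (n + m) (x * y).
Proof.
elim: n x => [|n IHn] x /=; first exact: prime_factors_unitM.
move=> [p [b [pp -> hb]]] hy; exists p, (b * y); rewrite mulrA; split=> //.
exact: IHn.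
Qed.

Lemma prime_factors_saturated n x y : prime_factors n (x * y) ->
  exists m, prime_factors m x.
Proof.
elim: n x y => [|n IHn] x y /=; first by move=> /principal_unit_mul; exists 0%N.
move=> [p [b [pp e hb]]]; have [p0 [_ _ prM]] := pp.
have : principal p (x * y) by exists b; rewrite e mulrC.
case/prM => -[c cE].
  have [|m hm] := IHn c y.
    by rewrite (_ : c * y = b) //; apply: (mulfI p0); rewrite -e cE mulrA [p * c]mulrC.
  by exists m.+1, p, c; rewrite mulrC.
apply: (IHn x c); rewrite (_ : x * c = b) //; apply: (mulfI p0).
by rewrite -e cE mulrCA [p * c]mulrC.
Qed.

Lemma prime_ideal_prime_factor (P : set A) n a : prime_ideal P -> P a ->
  prime_factors n a -> exists2 p, P p & prime_elt p.
Proof.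
move=> prP; have [idP _ prM] := prP; elim: n a => [|n IHn] a Pa /=.
  move=> [c e]; case: (prime_ideal1 prP); rewrite e; exact: ideal_mull.
move=> [p [b [pp aE hb]]]; move: Pa; rewrite aE => /prM[Pp|Pb]; first by exists p.
exact: IHn Pb hb.
Qed.

Definition primes_have_prime_elts := forall P : set A,
  prime_ideal P -> P <> [set 0] -> exists2 p, P p & prime_elt p.

Lemma ideal_neq0 (P : set A) : is_ideal P -> P <> [set 0] -> exists2 a, P a & a != 0.
Proof.
move=> idP P0; apply: contrapT => no; apply: P0; apply/seteqP; split=> x.
  by move=> Px; apply: contrapT => /eqP x0; apply: no; exists x.
by move=> ->; apply: ideal0.
Qed.

(* Kaplansky: an ideal maximal among those avoiding the saturated set of       *)
(* products of primes is prime, hence contains a prime element.                *)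
Theorem kaplansky : primes_have_prime_elts -> factorial.
Proof.
move=> hP a a0; apply: contrapT => na.
pose S x := exists n, prime_factors n x.
pose good X := [/\ is_ideal X, X a & forall x, X x -> ~ S x].
have good_a : good (principal a).
  split; [exact: principal_ideal | exact: principal_id | ].
  move=> _ [c ->] [n]; rewrite mulrC => /prime_factors_saturated[m hm].
  by apply: na; exists m.
have [|M [Mgood Mmax]] := @Zorn_bigcup _ [set X | X = set0 \/ good X].
  move=> F FP Ftot.
  have [Fne|Fe] := pselect (exists2 X, F X & good X); last first.
    left; apply/seteqP; split=> // x [X FX Xx].
    by have [X0|Xg] := FP X FX; [rewrite X0 in Xx | case: Fe; exists X].
  right; have [X FX [idX Xa Xn]] := Fne.
  have FPg Y y : F Y -> Y y -> good Y.
    by move=> FY Yy; case: (FP Y FY) => // Y0; rewrite Y0 in Yy.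
  split; [split|by exists X|].
  - by exists X => //; apply: ideal0.
  - move=> x y [Y FY Yx] [Z FZ Zy]; have [idY _ _] := FPg _ _ FY Yx.
    have [idZ _ _] := FPg _ _ FZ Zy; have [YZ|ZY] := Ftot Y Z FY FZ.
      by exists Z => //; apply: idealD => //; apply: YZ.
    by exists Y => //; apply: idealD => //; apply: ZY.
  - move=> b x [Y FY Yx]; have [idY _ _] := FPg _ _ FY Yx.
    by exists Y => //; apply: ideal_mull.
  - by move=> x [Y FY Yx]; have [_ _] := FPg _ _ FY Yx; apply.
have {Mgood} [idM Ma Mn] : good M.
  case: Mgood => // M0; case: (Mmax (principal a)); last by right.
  by rewrite M0; split=> // /(_ a (principal_id a)).
(* By maximality, the ideal generated by [M] and [x] meets [S]. *)
have ext x : ~ M x -> exists s u, S s /\ M (s - u * x).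
  move=> Mx; pose Q := [set z | exists u, M (z - u * x)].
  have idQ : is_ideal Q.
    split; first by exists 0; rewrite mul0r subrr; apply: ideal0.
      move=> z w [u hu] [v hv]; exists (u + v).
      by rewrite mulrDl opprD addrACA; apply: idealD.
    move=> b z [u hu]; exists (b * u).
    by rewrite -mulrA -mulrBr; apply: ideal_mull.
  have MQ : M `<=` Q by move=> z Mz; exists 0; rewrite mul0r subr0.
  apply: contrapT => no; apply: (Mmax Q); last first.
    right; split=> //; first exact: MQ.
    by move=> z [u hu] Sz; apply: no; exists z, u.
  split=> // QM; apply: Mx; apply: QM; exists 1.
  by rewrite mul1r subrr; apply: ideal0.
have prM : prime_ideal M.
  split=> // [MT|x y Mxy]; first by apply: (Mn 1); rewrite ?MT //; exists 0%N; apply: principal_id.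
  have [Mx|/ext[s [u [[n hs] Msu]]]] := pselect (M x); first by left.
  have [My|/ext[t [v [[m ht] Mtv]]]] := pselect (M y); first by right.
  case: (Mn (s * t)); last by exists (n + m)%N; apply: prime_factorsM.
  have -> : s * t = (s - u * x) * t + u * x * (t - v * y) + u * v * (x * y) by ring.
  by do 2?apply: idealD => //; [apply: ideal_mulr|apply: ideal_mull|apply: ideal_mull].
have [|p Mp pp] := hP M prM; first by move=> M0; move: Ma a0; rewrite M0 => ->; rewrite eqxx.
apply: (Mn p Mp); exists 1%N, p, 1; rewrite mulr1; split=> //.
exact: principal_id.
Qed.

Lemma factorial_primes : factorial -> primes_have_prime_elts.
Proof.
move=> fA P prP P0; have [idP _ _] := prP.
have [a Pa /fA[n ha]] := ideal_neq0 idP P0.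
exact: prime_ideal_prime_factor Pa ha.
Qed.

End Factorization.

(** * Gauss's lemma and primes of [A[X]] *)

Section Gauss.
Variable A : idomainType.

(** [V[X]] is prime: one of the two leading coefficients lies in [V], and stripping that leading
    term lowers the total size. *)
Lemma coef_prime_ideal (V : set A) (p q : {poly A}) : prime_ideal V ->
  (forall i, V (p * q)`_i) -> (forall i, V p`_i) \/ (forall i, V q`_i).
Proof.
move=> prV; have [idV _ prM] := prV.
have strip (f : {poly A}) : f != 0 -> V (lead_coef f) ->
    exists g : {poly A}, (size g < size f)%N /\
      ((forall i, V (f - g)`_i) /\ ((forall i, V g`_i) -> forall i, V f`_i)).
  move=> f0 Vl; exists (f - lead_coef f *: 'X^((size f).-1)); split; last split.
  - exact: size_drop_lead.
  - by move=> i; rewrite subKr coefZ; apply: ideal_mulr.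
  - move=> Vg i; apply: (idealBK idV (y := (lead_coef f *: 'X^((size f).-1))`_i)).
      by rewrite -coefB.
    by rewrite coefZ; apply: ideal_mulr.
have coefM_ideal (f g : {poly A}) : (forall i, V f`_i) -> forall i, V (f * g)`_i.
  by move=> Vf i; rewrite coefM; apply: ideal_sum => // j _; apply: ideal_mulr.
have [l lpq] := ubnP (size p + size q); elim: l => // l IHl in p q lpq *.
move=> Vpq; have [->|p0] := eqVneq p 0.
  by left=> i; rewrite coef0; apply: ideal0.
have [->|q0] := eqVneq q 0; first by right=> i; rewrite coef0; apply: ideal0.
have : V (lead_coef p * lead_coef q).
  by rewrite -lead_coefM; apply: Vpq.
case/prM => [/(strip p p0)|/(strip q q0)] [g [gs [Vfg Vg]]].
  have [||/Vg|] := IHl g q; [by lia| |by left|by right].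
  move=> i; rewrite -[g](subKr p) mulrBl coefB; apply: idealB => //.
  exact: coefM_ideal.
have [||Vp|/Vg] := IHl p g; [by lia| |by left|by right].
move=> i; rewrite -[g](subKr q) mulrBr coefB; apply: idealB => //.
by rewrite mulrC; apply: coefM_ideal.
Qed.

Lemma principal_polyC (a : A) (p : {poly A}) :
  principal a%:P p <-> forall i, principal a p`_i.
Proof.
split=> [[c ->] i|/choice[c hc]]; first by exists c`_i; rewrite coefMC.
exists (\poly_(i < size p) c i); apply/polyP => i; rewrite coefMC coef_poly.
by case: ltnP => [_|le]; [exact: hc | rewrite nth_default // mul0r].
Qed.

Lemma prime_elt_polyC (a : A) : prime_elt a -> prime_elt a%:P.
Proof.
move=> [a0 pra]; split; first by rewrite polyC_eq0.
split; first exact: principal_ideal.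
  move=> T; apply: (prime_ideal1 pra).
  have /principal_polyC/(_ 0%N) : principal a%:P 1 by rewrite T.
  by rewrite coef1.
move=> p q /principal_polyC/(coef_prime_ideal pra)[h|h]; [left|right];
  exact/principal_polyC.
Qed.

(* A polynomial of least degree in [P], with as few prime factors as possible  *)
(* in its leading coefficient, is primitive and so generates [P].              *)
Theorem gauss : factorial A -> primes_have_prime_elts {poly A}.
Proof.
move=> fA P prP P0; have [idP _ prM] := prP.
have [[c c0 Pc]|noC] := pselect (exists2 c : A, c != 0 & P c%:P).
  have [n hn] := fA c c0.
  have [p Pp pp] := prime_ideal_prime_factor (prime_ideal_preimage (@polyC A) prP) Pc hn.
  by exists p%:P => //; apply: prime_elt_polyC.
have PC c : P c%:P -> c = 0.
  by move=> Pc; apply/eqP; apply: contrapT => /negP c0; apply: noC; exists c.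
have exd : exists d, `[< exists g, [/\ P g, g != 0 & size g = d] >].
  have [g Pg g0] := ideal_neq0 idP P0.
  by exists (size g); apply/asboolP; exists g.
have [d /asboolP[g1 [Pg1 g10 sg1]] dmin] := ex_minnP exd.
have exn : exists n, `[< exists g, [/\ P g, g != 0, size g = d &
    prime_factors n (lead_coef g)] >].
  have [|n hn] := fA (lead_coef g1); first by rewrite lead_coef_eq0.
  by exists n; apply/asboolP; exists g1.
have [n /asboolP[g [Pg g0 sg hn]] nmin] := ex_minnP exn.
(* The quotient by a prime constant would lie in [P] with the same size and one prime factor fewer
   in its leading coefficient. *)
have prim p : prime_elt p -> ~ principal p%:P g.
  move=> pp [h gE]; have [p0 _] := pp.
  have h0 : h != 0 by apply: contraNneq g0 => h0; rewrite gE h0 mul0r.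
  have Ph : P h.
    by move: Pg; rewrite gE => /prM[] // /PC p00; rewrite p00 eqxx in p0.
  move: hn; rewrite gE mulrC lead_coefM lead_coefC.
  move=> /(prime_factors_divP pp)[m nm hm].
  have : (n <= m)%N.
    apply: nmin; apply/asboolP; exists h; split=> //.
    by rewrite -sg gE mulrC mul_polyC size_scale.
  by rewrite nm ltnn.
(* The prime factors of [c] are removed one by one: each divides [q], as it cannot divide [g]. *)
have cancelC c h q : c != 0 -> c%:P * h = q * g -> principal g h.
  move=> /fA[m]; elim: m c h q => [|m IHm] c h q /=.
    move=> [u e] ch; exists (u%:P * q).
    by rewrite -mulrA -ch mulrA -polyCM -e mul1r.
  move=> [p [b [pp -> hb]]] e; have [pC0 [_ _ prpM]] := prime_elt_polyC pp.
  have : principal p%:P (q * g) by exists (b%:P * h); rewrite -e polyCM; ring.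
  case/prpM => [[q' qE]|/(prim p pp)//].
  apply: (IHm b h q' hb); apply: (mulfI pC0).
  by rewrite mulrA -polyCM e qE; ring.
(* Pseudo-division by [g] leaves a remainder in [P] of smaller size, hence zero; the power of the
   leading coefficient then cancels. *)
have PE : P = principal g.
  apply/seteqP; split=> [h Ph|_ [c ->]]; last exact: ideal_mull.
  pose c := lead_coef g ^+ Pdiv.Ring.rscalp h g.
  set r := Pdiv.Ring.rmodp h g.
  have e : c *: h = Pdiv.Ring.rdivp h g * g + r by apply: Pdiv.ComRing.rdivp_eq.
  have Pr : P r.
    have -> : r = c%:P * h - Pdiv.Ring.rdivp h g * g.
      by rewrite mul_polyC e addrC addKr.
    by apply: idealB => //; apply: ideal_mull.
  have r0 : r = 0.
    apply: contrapT => /eqP r0; have : (d <= size r)%N.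
      by apply: dmin; apply/asboolP; exists r.
    by rewrite leqNgt -sg Pdiv.Ring.ltn_rmodp g0.
  apply: (cancelC c h (Pdiv.Ring.rdivp h g)).
    by rewrite expf_neq0 // lead_coef_eq0.
  by rewrite mul_polyC e r0 addr0.
by exists g => //; split=> //; rewrite -PE.
Qed.

End Gauss.

Lemma primes_have_prime_elts_iso (R S : idomainType) (phi : {rmorphism R -> S})
    (psi : {rmorphism S -> R}) : cancel phi psi -> cancel psi phi ->
  primes_have_prime_elts R -> primes_have_prime_elts S.
Proof.
move=> phiK psiK hR P prP P0.
have [|p Pp [p0 prp]] := hR _ (prime_ideal_preimage phi prP).
  move=> e; apply: P0; apply/seteqP; split=> x.
    move=> Px; have : (phi @^-1` P) (psi x) by rewrite /= psiK.
    by rewrite e => /= x0; rewrite -[x]psiK x0 rmorph0.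
  by move=> ->; apply: ideal0; have [] := prP.
exists (phi p) => //; split; first by rewrite -(inj_eq (can_inj phiK)) rmorph0 in p0 *.
have -> : principal (phi p) = psi @^-1` principal p.
  apply/seteqP; split=> x [c].
    by move=> ->; exists (psi c); rewrite rmorphM phiK.
  by move=> e; exists (phi c); rewrite -rmorphM -e psiK.
exact: prime_ideal_preimage.
Qed.

Theorem factorial_mpoly (k : fieldType) n : factorial {mpoly k[n]}.
Proof.
elim: n => [|n IHn].
  move=> a; rewrite (nvar0_mpolyC a) mpolyC_eq0 => a0; exists 0%N.
  by exists (a@_0%MM)^-1%:MP; rewrite -mpolyCM mulVf // mpolyC1.
apply: kaplansky; apply: (primes_have_prime_elts_iso (@of_uniK k n) (@muniK k n)).
exact: gauss.
Qed.

(** [P] contains a prime element [p], and a strict inclusion of [principal p] would give a chain of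
    length 2 from zero to [P]. *)
Lemma height1_principal (k : fieldType) n (P : set {mpoly k[n]}) :
  prime_ideal P -> prime_height P 1 ->
  exists2 p, prime_elt p & P = principal p.
Proof.
move=> prP hP; have [idP _ _] := prP.
have P0 : P <> [set 0].
  move=> P0; have [[c [prc ltc cP]] _] := hP.
  have [_] := ltc 0%N isT; apply; rewrite cP P0 => _ ->.
  by apply: ideal0; have [] := prc 0%N isT.
have [p Pp pp] := factorial_primes (@factorial_mpoly k n) prP P0.
exists p => //; apply: contrapT => ne; have [p0 prp] := pp.
have sub : principal p `<=` P by move=> _ [c ->]; apply: ideal_mull.
have [_ /(_ 2%N)] := hP; suff h : prime_chain_to P 2 by move=> /(_ h).
have prZ := zero_prime_ideal {mpoly k[n]}.
exists (fun i => if i is 0%N then [set 0] else if i is 1%N then principal p else P).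
split=> //.
- by move=> [|[|i]].
- move=> [|[|i]] // _.
    split=> [_ ->|/(_ p (principal_id p)) /eqP]; last by rewrite (negbTE p0).
    by apply: ideal0; apply: principal_ideal.
  by split=> // Ps; apply: ne; apply/seteqP.
Qed.

(** * Adding components of height 1 or n *)

(* An element [y] of all components but [Q j] lies outside the radical of      *)
(* [Q j], so [x y \in I] for [x] in that radical forces [x \in Q j].           *)
Lemma radical_component_prime (R : comNzRingType) (I : set R) r
    (Q : 'I_r -> set R) j : radical_ideal I ->
  irredundant_primary_decomposition I Q -> prime_ideal (Q j).
Proof.
move=> [_ radI] [prQ IE irr].
have [idQ QT primQ] := prQ j.
have inI x y m : (forall l, l <> j -> Q l y) -> Q j (x ^+ m) -> I (x * y).
  move=> Qy Qx; apply: (radI _ m.+1); rewrite IE => l _.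
  have [idl _ _] := prQ l; rewrite exprMn.
  have [->|/eqP lj] := eqVneq l j.
    by rewrite exprS; apply: ideal_mulr => //; apply: ideal_mull.
  by rewrite [y ^+ _]exprS; apply: ideal_mull => //; apply: ideal_mulr => //; apply: Qy.
have [y [Qy nQy]] := nonsubset (irr j).
have Qy' l : l <> j -> Q l y by move=> lj; apply: Qy.
have ny m : ~ Q j (y ^+ m).
  move=> Qm; apply: nQy; have Iy : I y.
    apply: (radI _ 2); rewrite expr2; exact: inI Qm.
  by rewrite IE in Iy; apply: Iy.
have rad x m : Q j (x ^+ m) -> Q j x.
  move=> Qx; have : I (x * y) by apply: inI Qx.
  by rewrite IE => /(_ j Logic.I)/primQ[|[l]] // /ny.
by split=> // x z /primQ[|[m /rad]]; [left|right].
Qed.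

Section AddComponents.
Variables (k : fieldType) (n : nat) (I : set {mpoly k[n]}) (r : nat).
Variable Q : 'I_r -> set {mpoly k[n]}.
Hypothesis radI : radical_ideal I.
Hypothesis decQ : irredundant_primary_decomposition I Q.
Implicit Types S : set 'I_r.

Let K S := \bigcap_(l in S) Q l.

Let prQ j : prime_ideal (Q j). Proof. exact: radical_component_prime decQ. Qed.

Let irrQ j : ~ (\bigcap_(l in [set l | l <> j]) Q l `<=` Q j).
Proof. by have [_ _] := decQ; apply. Qed.

Let fgI (J : set {mpoly k[n]}) : is_ideal J -> fin_gen J.
Proof. exact: noetherian_mpoly (@noetherian_field k) J. Qed.

Lemma bigcap_component_ideal S : is_ideal (K S).
Proof.
split=> [l _|x y Kx Ky l Sl|a x Kx l Sl]; have [idl _ _] := prQ l.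
- exact: ideal0.
- by apply: idealD => //; [apply: Kx | apply: Ky].
- by apply: ideal_mull => //; apply: Kx.
Qed.

(** With [Q j] generated by [p], the intersection is [p K S]: [p] lies in no other component, so it
    cancels modulo each of them. *)
Lemma rt_le_add_height1 j S N : (1 <= N)%N -> ~ S j -> prime_height (Q j) 1 ->
  rt_le (Q j `&` K S) N <-> rt_le (K S) N.
Proof.
move=> N1 nSj /(height1_principal (prQ j))[p [p0 prp] QE].
suff -> : Q j `&` K S = [set p * x | x in K S].
  by apply: rt_le_scale => //; apply/fgI/bigcap_component_ideal.
have Qjp : Q j p by rewrite QE; apply: principal_id.
apply/seteqP; split=> x.
  move=> [+ Kx]; rewrite QE => -[c xE]; exists c; last by rewrite xE mulrC.
  move=> l Sl; have [idl _ prl] := prQ l.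
  have := Kx l Sl; rewrite xE => /prl[//|Qlp].
  (* If [p] were in [Q l], then [Q j] would lie inside [Q l], making [Q l] redundant. *)
  case: (irrQ (j := l)) => z Qz; have : Q j z by apply: (Qz j) => /= jl; apply: nSj; rewrite jl.
  by rewrite QE => -[d ->]; apply: ideal_mull.
have [idj _ _] := prQ j; have idK := bigcap_component_ideal S.
by move=> [y Ky <-]; split; [apply: ideal_mulr | exact: (ideal_mull p idK Ky)].
Qed.

(** An element of all other components outside [Q j] is invertible modulo [Q j], so [Q j] and [K S]
    are comaximal; the bound for [Q j] always holds, by linear type. *)
Lemma rt_le_add_height_max j S N : (1 <= N)%N -> ~ S j -> prime_height (Q j) n ->
  rt_le (Q j `&` K S) N <-> rt_le (K S) N.
Proof.
move=> N1 nSj [[c [prc ltc cQ]] _].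
have algQ : algebraic_mod (Q j) by rewrite -cQ; apply: chain_algebraic.
have [x [Qx nQjx]] := nonsubset (irrQ (j := j)).
have Kx : K S x by move=> l Sl; apply: Qx => lj; apply: nSj; rewrite -lj.
have [b Qb] := algebraic_mod_inverse (prQ j) algQ nQjx.
have [idj _ _] := prQ j; have idK := bigcap_component_ideal S.
have idI : is_ideal (Q j `&` K S).
  split; first by split; [exact: ideal0 idj | exact: ideal0 idK].
    by move=> y z [Qy Ky] [Qz Kz]; split; [exact: (idealD idj)|exact: (idealD idK)].
  by move=> a y [Qy Ky]; split; [exact: (ideal_mull _ idj)|exact: (ideal_mull _ idK)].
have Q1xb : Q j (1 - x * b) by rewrite -opprB; apply: idealN.
have Kxb : K S (x * b) by exact: (ideal_mulr b idK Kx).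
rewrite (rt_le_comaximal N1 Q1xb Kxb (subrK _ _)); try exact: fgI.
split=> [[]//|rtK]; split=> //.
exact: rt_le_mono N1 (algebraic_prime_rt_le1 (prQ j) algQ).
Qed.

Lemma rt_le_components S N : (1 <= N)%N ->
  (forall j, ~ S j -> prime_height (Q j) 1 \/ prime_height (Q j) n) ->
  rt_le I N <-> rt_le (K S) N.
Proof.
move=> N1 hS.
(* All components are added along a list; those already present change nothing. *)
suff key (s : seq 'I_r) : rt_le (K (S `|` [set` s])) N <-> rt_le (K S) N.
  suff -> : I = K (S `|` [set` enum 'I_r]) by exact: key.
  have [_ -> _] := decQ; apply/seteqP; split=> x Kx l _; apply: Kx => //.
  by right; rewrite /= mem_enum.
elim: s => [|j s IHs].
  suff -> : S `|` [set` [::]] = S by [].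
  by apply/seteqP; split=> [x [|//]|x]; [|left].
have [Tj|nTj] := pselect ((S `|` [set` s]) j).
  suff -> : S `|` [set` j :: s] = S `|` [set` s] by [].
  apply/seteqP; split=> x [Sx|]; try by left.
    by rewrite /= inE => /predU1P[->|xs] //; right.
  by move=> xs; right; rewrite /= inE xs orbT.
have -> : K (S `|` [set` j :: s]) = Q j `&` K (S `|` [set` s]).
  apply/seteqP; split=> x.
    move=> Kx; split; first by apply: Kx; right; rewrite /= inE eqxx.
    by move=> l [Sl|sl]; apply: Kx; [left | right; rewrite /= inE sl orbT].
  move=> [Qx Kx] l [Sl|]; first by apply: Kx; left.
  by rewrite /= inE => /predU1P[->|sl] //; apply: Kx; right.
rewrite -IHs; have [|h1|hn] := hS j; first by move=> Sj; apply: nTj; left.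
  exact: rt_le_add_height1.
exact: rt_le_add_height_max.
Qed.

End AddComponents.

Theorem proposition4p4 (k : fieldType) (n : nat) (hn : (3 <= n)%N)
    (I : set {mpoly k[n]}) (hrad : radical_ideal I)
    (hnonzero : I <> [set 0]) (hproper : I <> setT)
    (E : nat -> set {mpoly k[n]})
    (hE : equidimensional_decomposition n I E) :
  relation_type I 1 \/
  (exists2 i : nat, (2 <= i <= n.-1)%N & E i <> setT) /\
  (exists N : nat, relation_type I N /\
     relation_type (\bigcap_(i in [set i : nat | (2 <= i <= n.-1)%N]) E i) N).
Proof.
have [r [Q [decQ EQ]]] := hE; have [_ IE _] := decQ.
have prQ j : prime_ideal (Q j) by apply: radical_component_prime decQ.
have Q0 j : Q j <> [set 0].
  move=> Qj0; apply: hnonzero; apply/seteqP; split=> x.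
    by rewrite IE => /(_ j Logic.I); rewrite Qj0.
  by move=> ->; apply: ideal0; case: hrad.
pose S := [set j | exists2 i, (2 <= i <= n.-1)%N & ideal_height (Q j) i].
have EQ' i : (2 <= i <= n.-1)%N -> E i = equidimensional_component Q i.
  by move=> i2n; apply: EQ; lia.
have -> : \bigcap_(i in [set i | (2 <= i <= n.-1)%N]) E i = \bigcap_(j in S) Q j.
  apply/seteqP; split=> x hx.
    by move=> j [i i2n hj]; have := hx i i2n; rewrite EQ' //; apply.
  by move=> i i2n; rewrite EQ' // => j hj; apply: hx; exists i.
(* A component outside [S] has height 1 or n, the only other heights possible. *)
have rtS N : (1 <= N)%N -> rt_le I N <-> rt_le (\bigcap_(j in S) Q j) N.
  move=> N1; apply: rt_le_components => // j nSj.
  have [h hQ] := prime_height_exists (prQ j).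
  have h0 := prime_height_gt0 (prQ j) (@Q0 j) hQ.
  have hle : (h <= n)%N by have [] := hQ => /prime_chain_le.
  have [h1|h1] := eqVneq h 1%N; first by left; rewrite -h1.
  have [hn'|hn'] := eqVneq h n; first by right; rewrite -[X in prime_height _ X]hn'.
  by case: nSj; exists h; [lia | apply: prime_height_ideal_height].
have [[j Sj]|Se] := pselect (exists j, S j); last first.
  left; apply/relation_typeP; split=> //; apply/rtS => //.
  suff -> : \bigcap_(j in S) Q j = setT by apply: rt_le_setT.
  by apply/seteqP; split=> // x _ j Sj; case: Se; exists j.
right; split.
  have [i i2n hj] := Sj; exists i => // ET; apply: (prime_ideal1 (prQ j)).
  have : E i 1 by rewrite ET.
  by rewrite EQ' //; apply.
have idS := bigcap_component_ideal hrad decQ S.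
have [N rtN] := noetherian_rt_le (noetherian_mpoly (@noetherian_field k)) idS.
have [M rtM] := rt_le_relation_type rtN; exists M; split=> //.
by apply: relation_type_transfer rtM => N' N'1; split=> /(rtS N' N'1).
Qed.
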